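(* Let $\lambda=(\lambda_1>\cdots>\lambda_n)\in\mathbb{R}^n$. Then the symmetric Toda flow $\dot L=[L,\pi_{\mathfrak{u}}(-\mathrm{i}L)]$ on $\mathcal{O}_\lambda$ is, upon applying the twist map $\vartheta_\lambda$, the gradient flow on $\mathcal{O}_\lambda$ in the Kähler metric with respect to $\mathrm{Diag}(-\mathrm{i}\lambda_1,\dots,-\mathrm{i}\lambda_n)\in\mathfrak{u}_n$.
   Context: Here $\mathrm{i}=\sqrt{-1}$, $[n]=\{1,\dots,n\}$, $\mathrm{Diag}(c_1,\dots,c_n)$ is the diagonal matrix with diagonal entries $c_1,\dots,c_n$, and $\mathrm{U}_n$ is the unitary group with Lie algebra $\mathfrak{u}_n$ of skew-Hermitian $n\times n$ matrices. $[L,M]=LM-ML$ and $\mathrm{ad}_L=[L,\cdot]$. Adjoint orbit: $\mathcal{O}_\lambda=\{g(\mathrm{i}\,\mathrm{Diag}(\lambda))g^{-1}:g\in\mathrm{U}_n\}\subset\mathfrak{u}_n$. Projection: for $N\in\mathfrak{gl}_n(\mathbb{C})$, $\pi_{\mathfrak{u}}(N)$ is the unique element of $\mathfrak{u}_n$ such that $N-\pi_{\mathfrak{u}}(N)$ is upper-triangular with real diagonal entries. Flags: $\mathrm{Fl}_n(\mathbb{C})=\mathrm{GL}_n(\mathbb{C})/\mathrm{B}_n(\mathbb{C})$, with $\mathrm{B}_n(\mathbb{C})$ the invertible upper-triangular matrices; the class of $g$ is identified with the complete flag $(V_1,\dots,V_{n-1})$, $V_k$ being the span of the first $k$ columns of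 $g$. There is an isomorphism $\mathcal{O}_\lambda\cong\mathrm{Fl}_n(\mathbb{C})$, $g(\mathrm{i}\,\mathrm{Diag}(\lambda))g^{-1}\mapsto g$ (for $g\in\mathrm{U}_n$). For $I\subseteq[n]$ with $|I|=k$, $\Delta_I(g)$ is the minor of $g$ in rows $I$ and columns $1,\dots,k$. Schubert cells: for $w\in\mathfrak{S}_n$, let $\mathring{w}$ be the signed permutation matrix with nonzero entries $\pm1$ in positions $(w(j),j)$, signs chosen so that all $\Delta_I(\mathring w)\ge0$. Put $\mathring{X}^w=\mathrm{B}_n(\mathbb{C})\cdot\mathring{w}\subseteq\mathrm{Fl}_n(\mathbb{C})$; then $\mathrm{Fl}_n(\mathbb{C})=\bigsqcup_w\mathring{X}^w$. Twist map: let $\delta_n=\mathrm{Diag}(1,-1,1,\dots,(-1)^{n-1})$ and $\iota(g)=\delta_ng^{-1}\delta_n$ for $g\in\mathrm{GL}_n(\mathbb{C})$. For $V\in\mathring{X}^w$, the canonical representative of $V$ is the $g\in\mathrm{U}_n$ representing $V$ such that for all $1\le k\le n$, $\Delta_{w([k])}(g)\in\mathbb{R}_{>0}$ and $\Delta_I(g)=0$ for all $k$-element $I\subseteq[n]$ lexicographically greater than $w([k])$. Define $\vartheta(V)\in\mathrm{Fl}_n(\mathbb{C})$ to be the flag represented by $\iota(g)$. Then $\vartheta_\lambda:\mathcal{O}_\lambda\to\mathcal{O}_\lambda$ is the map induced by $\vartheta$ under $\mathcal{O}_\lambda\cong\mathrm{Fl}_n(\mathbb{C})$; explicitly $\vartheta_\lambda(g(\mathrm{i}\,\mathrm{Diag}(\lambda))g^{-1})=\delta_ng^{-1}(\mathrm{i}\,\mathrm{Diag}(\lambda))g\delta_n$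 for $g$ a canonical representative. It is a piecewise-smooth involution. Metrics: let $\nu(L,M)=2n\,\mathrm{tr}(LM)-2\,\mathrm{tr}(L)\mathrm{tr}(M)$. For $L\in\mathcal{O}_\lambda$ and $X\in\mathfrak{u}_n$, write uniquely $X=X^L+X_L$ with $X^L\in\mathrm{im}(\mathrm{ad}_L)$ and $X_L\in\ker(\mathrm{ad}_L)$ (with $\mathrm{ad}_L$ acting on $\mathfrak{u}_n$). Tangent vectors at $L$ have the form $[L,X]$, $X\in\mathfrak{u}_n$. The normal metric is $\langle[L,X],[L,Y]\rangle_{\mathrm{normal}}=-\nu(X^L,Y^L)$, and the Kähler metric is $\langle[L,X],[L,Y]\rangle_{\mathrm{K\ddot{a}hler}}=\langle\sqrt{-\mathrm{ad}_L^2}\,([L,X]),[L,Y]\rangle_{\mathrm{normal}}$, where $\sqrt{-\mathrm{ad}_L^2}$ is the positive square root of the positive semidefinite operator $-\mathrm{ad}_L^2$. Gradient flow with respect to $N\in\mathfrak{u}_n$ in a Riemannian metric on $\mathcal{O}_\lambda$: $\dot L(t)=\mathrm{grad}(H)(L(t))$, where $H(M)=\nu(M,N)$ for $M\in\mathcal{O}_\lambda$. ''Upon applying the twist map'' means that if $L(t)$ evolves by the symmetric Toda flow beginning at $L_0$, then $\vartheta_\lambda(L(t))$ evolves by the gradient flow beginning at $\vartheta_\lambda(L_0)$. *)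

(* Defs.v *)
From HB Require Import structures.
From mathcomp Require Import all_boot all_order all_fingroup all_algebra.
From mathcomp Require Import complex.
From mathcomp Require Import all_classical all_reals all_analysis.
Set Implicit Arguments.
Unset Strict Implicit.
Unset Printing Implicit Defensive.
Import Order.TTheory GRing.Theory Num.Theory.
Import numFieldNormedType.Exports.
Local Open Scope classical_set_scope.
Local Open Scope complex_scope.
Local Open Scope sesquilinear_scope.
Local Open Scope ring_scope.

(* Objects described in the mathematics as "the unique x such that P x" are
   written [xget x0 P]: some x satisfying P, or x0 if there is none. *)

Section Matrices.
Variables (R : realType) (n : nat).
Local Notation M := 'M[R[i]]_n.

Definition commx (L X : M) : M := L *m X - X *m L.

Definition skewherm : set M := [set X | X ^t* = - X].

(* is_trig_mx is lower-triangularity *)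
Definition is_upper_mx (A : M) : bool := is_trig_mx A^T.

Definition borel : set M := [set b | b \in unitmx /\ is_upper_mx b].

Definition i_diag (lambda : 'rV[R]_n) : M :=
  diag_mx (\row_j ('i * (lambda 0 j)%:C)).

Definition orbit_point (lambda : 'rV[R]_n) (g : M) : M :=
  g *m i_diag lambda *m invmx g.

Definition adjoint_orbit (lambda : 'rV[R]_n) : set M :=
  [set L | exists2 g, g \is unitarymx & L = orbit_point lambda g].

Definition pi_u (N : M) : M :=
  xget 0 [set P | [/\ skewherm P, is_upper_mx (N - P)
                    & forall i, (N - P) i i \is Num.real]].

End Matrices.

Section Flags.
Variables (R : realType) (n : nat).
Local Notation M := 'M[R[i]]_n.

(* A point of Fl_n = GL_n / B_n is represented by the coset g B_n, as a set of
   matrices. *)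
Definition flag_of (g : M) : set M :=
  [set h | exists2 b, borel b & h = g *m b].

Lemma card_set_ord (I : {set 'I_n}) : (#|I| <= n)%N.
Proof. by rewrite -[X in (_ <= X)%N](card_ord n) max_card. Qed.

(* enum_val lists I increasingly; the columns are the first #|I| ones. *)
Definition minor (I : {set 'I_n}) (g : M) : R[i] :=
  \det (mxsub (fun i : 'I_#|I| => enum_val i) (widen_ord (card_set_ord I)) g).

Definition perm_image (w : 'S_n) (k : nat) : {set 'I_n} :=
  [set w j | j in [set j : 'I_n | (j < k)%N]]%SET.

Definition lex_lt (I K : {set 'I_n}) : bool :=
  (([seq val i | i <- enum I] : seqlexi nat)
     < ([seq val i | i <- enum K] : seqlexi nat))%O.

(* On R[i], 0 <= z and 0 < z entail that z is real. *)
Definition signed_perm_mx (w : 'S_n) (A : M) : Prop :=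
  [/\ forall i j, i != w j -> A i j = 0,
      forall j, A (w j) j = 1 \/ A (w j) j = -1
    & forall I, 0 <= minor I A].

Definition schubert_cell (w : 'S_n) : set (set M) :=
  [set V | exists b A, [/\ borel b, signed_perm_mx w A & V = flag_of (b *m A)]].

Definition is_canonical_rep (V : set M) (g : M) : Prop :=
  [/\ g \is unitarymx, V = flag_of g &
      exists2 w, schubert_cell w V &
        forall k, (1 <= k <= n)%N ->
          0 < minor (perm_image w k) g /\
          forall I : {set 'I_n}, #|I| = k -> lex_lt (perm_image w k) I ->
            minor I g = 0].

Definition canonical_rep (V : set M) : M := xget 1%:M (is_canonical_rep V).

Definition delta : M := diag_mx (\row_(j < n) (-1) ^+ j).

Definition iota (g : M) : M := delta *m invmx g *m delta.

Definition twist (V : set M) : set M := flag_of (iota (canonical_rep V)).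

Definition orbit_to_flag (lambda : 'rV[R]_n) (L : M) : set M :=
  xget set0 [set V | exists g, [/\ g \is unitarymx, L = orbit_point lambda g
                                 & V = flag_of g]].

Definition flag_to_orbit (lambda : 'rV[R]_n) (V : set M) : M :=
  xget 0 [set L | exists g, [/\ g \is unitarymx, V = flag_of g
                              & L = orbit_point lambda g]].

Definition twist_orbit (lambda : 'rV[R]_n) (L : M) : M :=
  flag_to_orbit lambda (twist (orbit_to_flag lambda L)).

End Flags.

Section Metrics.
Variables (R : realType) (n : nat).
Local Notation M := 'M[R[i]]_n.

(* The expression is real for skew-Hermitian L and X, which are the only
   arguments that occur; Re makes the value an element of R. *)
Definition nu (L X : M) : R :=
  complex.Re (2 * n%:R * \tr (L *m X) - 2 * \tr L * \tr X).

Definition im_ad (L : M) : set M :=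
  [set Y | exists2 X, skewherm X & Y = commx L X].

Definition ker_ad (L : M) : set M := [set X | skewherm X /\ commx L X = 0].

(* X^L *)
Definition im_part (L X : M) : M :=
  xget 0 [set P | im_ad L P /\ ker_ad L (X - P)].

Definition normal_metric (L U V : M) : R :=
  xget 0 [set r | exists X Y,
    [/\ skewherm X /\ skewherm Y, U = commx L X, V = commx L Y
      & r = - nu (im_part L X) (im_part L Y)]].

(* The standard inner product Re tr(X^* Y) of skew-Hermitian matrices. *)
Definition u_dot (X Y : M) : R := - complex.Re (\tr (X *m Y)).

(* S is a positive square root of T as an R-linear operator on skewherm. *)
Definition is_pos_sqrt (T S : M -> M) : Prop :=
  [/\ forall X, skewherm X -> skewherm (S X),
      forall (a : R) X Y, skewherm X -> skewherm Y ->
        S (a%:C *: X + Y) = a%:C *: S X + S Y,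
      forall X Y, skewherm X -> skewherm Y -> u_dot (S X) Y = u_dot X (S Y),
      forall X, skewherm X -> 0 <= u_dot (S X) X
    & forall X, skewherm X -> S (S X) = T X].

Definition pos_sqrt (T : M -> M) : M -> M :=
  @xget (M -> M : choiceType) id (is_pos_sqrt T).

Definition kahler_metric (L U V : M) : R :=
  normal_metric L (pos_sqrt (fun X => - commx L (commx L X)) U) V.

End Metrics.

Section Flows.
Variables (R : realType) (n : nat).
Local Notation M := 'M[R[i]]_n.

(* f is differentiable at the real time t, with derivative D *)
Definition is_mx_derive (f : R -> M) (t : R) (D : M) : Prop :=
  forall i j,
    is_derive t (1 : R) (fun s => complex.Re (f s i j)) (complex.Re (D i j)) /\
    is_derive t (1 : R) (fun s => complex.Im (f s i j)) (complex.Im (D i j)).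

(* The tangent space of an adjoint orbit O at L is im_ad L. The vector [L, X]
   is the velocity at 0 of the curve s |-> e^(-sX) L e^(sX) in O; the value of
   dH_L on it is the derivative at 0 of H along any such curve. *)
Definition is_gradient (O : set M) (metric : M -> M -> M -> R) (H : M -> R)
    (L G : M) : Prop :=
  im_ad L G /\
  forall (X : M) (c : R -> M), skewherm X ->
    c 0 = L -> (forall s, O (c s)) -> is_mx_derive c 0 (commx L X) ->
    is_derive (0 : R) (1 : R) (H \o c) (metric L G (commx L X)).

Definition toda_flow (lambda : 'rV[R]_n) (J : set R) (L0 : M) (L : R -> M) :
    Prop :=
  [/\ L 0 = L0, forall t, J t -> adjoint_orbit lambda (L t)
    & forall t, J t ->
        is_mx_derive L t (commx (L t) (pi_u (- 'i *: L t)))].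

Definition gradient_flow (O : set M) (metric : M -> M -> M -> R) (H : M -> R)
    (J : set R) (L0 : M) (L : R -> M) : Prop :=
  [/\ L 0 = L0, forall t, J t -> O (L t)
    & forall t, J t ->
        exists2 G, is_gradient O metric H (L t) G & is_mx_derive L t G].

End Flows.

(* Main.v *)
(* Let A = -iL = P + U with P = pi_u A; then U is upper triangular with real
   diagonal, and L' = [L, P] says A' = [U, A].  Solve r' = U r with r(0) = 1, so
   that r is upper triangular with positive diagonal, and let g0 be the
   canonical representative of L(0) and Lambda = Diag(lambda).  With v = r g0,
   the matrix A v - v Lambda solves X' = U X with X(0) = 0, hence vanishes, and
   the Gram matrix W = v^* v satisfies W' = 2 W Lambda, so that
   W = exp(2 t Lambda).  Thus u = v exp(-t Lambda) is unitary, diagonalises L,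
   and satisfies u' = -P u.  If g0 = b S c with b, c in the Borel subgroup and S a
   signed permutation matrix for w, then u = (r b) S (c exp(-t Lambda)) with the
   numbers b_{w(j)w(j)} c_jj multiplied by positive factors: this is what keeps u
   the canonical representative of its flag.

   Hence the twisted curve is iota(u) (i Lambda) iota(u)^-1, whose velocity is
   delta u^* [P, i Lambda] u delta.  In the unitary frame of iota(u), the operator
   ad_M multiplies the coordinate (j, k) by i (lambda_j - lambda_k), so the
   Kaehler gradient of nu(., N) multiplies the coordinates of N by
   -|lambda_j - lambda_k|.  The two agree because P equals A below the diagonal
   and -A above it. *)
Require Import Defs.
From HB Require Import structures.
From mathcomp Require Import all_boot all_order all_fingroup all_algebra.
From mathcomp Require Import complex.
From mathcomp Require Import zify ring lra.
From mathcomp Require Import all_classical all_reals all_analysis.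
Set Implicit Arguments.
Unset Strict Implicit.
Unset Printing Implicit Defensive.
Import Order.TTheory GRing.Theory Num.Theory.
Import numFieldNormedType.Exports.
Local Open Scope classical_set_scope.
Local Open Scope complex_scope.
Local Open Scope ring_scope.

(** * Upper triangular matrices and minors *)

Section UpperTriangular.
Variables (R : realType) (n : nat).
Local Notation M := 'M[R[i]]_n.
Implicit Types (A b c g : M).

Lemma is_upper_mxP A :
  reflect (forall i j : 'I_n, (j < i)%N -> A i j = 0) (is_upper_mx A).
Proof.
apply: (iffP is_trig_mxP) => uA i j ij; first by rewrite -(uA j i ij) mxE.
by rewrite mxE uA.
Qed.

Lemma det_upper A : is_upper_mx A -> \det A = \prod_i A i i.
Proof. by move=> uA; rewrite -det_tr det_trig//; apply: eq_bigr => i _; rewrite mxE. Qed.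

Lemma borelP b : borel b <-> is_upper_mx b /\ forall i, b i i != 0.
Proof.
split=> [[]|[ub b0]].
  rewrite unitmxE unitfE => d0 ub; split=> // i.
  by move: d0; rewrite det_upper// => /prodf_neq0; apply.
by split=> //; rewrite unitmxE unitfE det_upper//; apply/prodf_neq0 => i _.
Qed.

Lemma mul_upper_mx b c : is_upper_mx b -> is_upper_mx c -> is_upper_mx (b *m c).
Proof.
move=> /is_upper_mxP ub /is_upper_mxP uc; apply/is_upper_mxP => i j ji.
rewrite mxE big1// => k _; have [ki|ik] := ltnP k i; first by rewrite ub// mul0r.
by rewrite uc ?mulr0//; exact: leq_trans ji ik.
Qed.

Lemma mul_upper_diag b c i : is_upper_mx b -> is_upper_mx c ->
  (b *m c) i i = b i i * c i i.
Proof.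
move=> /is_upper_mxP ub /is_upper_mxP uc; rewrite mxE (bigD1 i)//= big1 ?addr0//.
move=> k; rewrite neq_ltn => /orP[ki|ik]; first by rewrite ub// mul0r.
by rewrite uc// mulr0.
Qed.

Lemma borel_mul b c : borel b -> borel c -> borel (b *m c).
Proof.
move=> /borelP[ub b0] /borelP[uc c0]; apply/borelP; split; first exact: mul_upper_mx.
by move=> i; rewrite mul_upper_diag// mulf_neq0.
Qed.

Lemma borel_diag (d : 'rV[R[i]]_n) : (forall i, d 0 i != 0) -> borel (diag_mx d).
Proof.
move=> d0; apply/borelP; split; last by move=> i; rewrite mxE eqxx mulr1n.
by apply/is_upper_mxP => i j ji; rewrite mxE -val_eqE (gtn_eqF ji).
Qed.

Lemma borel1 : borel (1%:M : M).
Proof. by rewrite -diag_const_mx; apply: borel_diag => i; rewrite mxE oner_eq0. Qed.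

(** Back substitution: in [b *m invmx b = 1%:M], row [i] involves only the rows of [invmx b] from
    [i] down, so the rows are treated from the last one upwards. *)
Lemma borel_inv b : borel b -> borel (invmx b).
Proof.
move=> bb; have [ub b0] := (borelP b).1 bb; have [bu _] := bb.
split; first by rewrite unitmx_inv.
have {}ub := is_upper_mxP _ ub; apply/is_upper_mxP => i j.
have [m] := ubnP (n - i); elim: m i => // m IHm i im ji.
have /matrixP/(_ i j) := mulmxV bu.
rewrite !mxE (bigD1 i)//= big1 ?addr0 => [|k].
  by rewrite -val_eqE (gtn_eqF ji) => /eqP; rewrite mulf_eq0 (negPf (b0 i)) => /eqP.
rewrite neq_ltn => /orP[ki|ik]; first by rewrite ub// mul0r.
rewrite IHm ?mulr0//; last exact: ltn_trans ji ik.
by move: ik (ltn_ord k) => /=; lia.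
Qed.

(* The inverse of [c] is both upper and lower triangular. *)
Lemma unitary_borel_diag c : c \is unitarymx -> borel c ->
  exists2 d : 'rV[R[i]]_n, c = diag_mx d & forall i, `|d 0 i| = 1.
Proof.
move=> uc bc; have [_ /is_upper_mxP tc] := bc.
have [_ /is_upper_mxP] := borel_inv bc; rewrite invmx_unitary// => tcV.
have ce i j : i != j -> c i j = 0.
  rewrite neq_ltn => /orP[ij|/tc//].
  by have := tcV _ _ ij; rewrite !mxE => /eqP; rewrite conjC_eq0 => /eqP.
exists (\row_i c i i).
  apply/matrixP => i j; rewrite !mxE; have [->|/ce->] := eqVneq i j.
    by rewrite mulr1n.
  by rewrite mulr0n.
move=> i; rewrite mxE; have /unitarymxP/matrixP/(_ i i) := uc.
rewrite !mxE (bigD1 i)//= big1 ?addr0 => [|k ki]; last by rewrite ce 1?eq_sym// mul0r.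
by rewrite !mxE eqxx mulr1n -normCK => /eqP; rewrite pexpr_eq1// => /eqP.
Qed.

End UpperTriangular.

(** * Minors and lexicographic order *)

Section Minors.
Variables (R : realType) (n : nat).
Local Notation M := 'M[R[i]]_n.
Implicit Types (A b g : M) (I K : {set 'I_n}) (w : 'S_n).

(** The first [#|I|] columns of [g *m c] combine only the first [#|I|] columns of [g], so the
    submatrix factors through the leading block of [c], which is triangular. *)
Lemma minor_mul_upper g (c : M) I : is_upper_mx c ->
  minor I (g *m c) = minor I g * \prod_(j < n | (j < #|I|)%N) c j j.
Proof.
move=> /is_upper_mxP uc; set wd := widen_ord (card_set_ord I).
have -> : minor I (g *m c) =
    \det (mxsub (fun i : 'I_#|I| => enum_val i) wd g *m mxsub wd wd c).
  congr (\det _); apply/matrixP => i j; rewrite !mxE.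
  rewrite (bigID (fun k : 'I_n => (k < #|I|)%N))/= [X in _ + X]big1 ?addr0.
    by rewrite (big_ord_narrow (card_set_ord I)); apply: eq_bigr => k _; rewrite !mxE.
  by move=> k; rewrite -leqNgt => Ik; rewrite uc ?mulr0//=; exact: leq_trans Ik.
rewrite det_mulmx; congr (_ * _).
rewrite det_upper.
  rewrite (big_ord_narrow (card_set_ord I)).
  by apply: eq_bigr => k _; rewrite !mxE.
by apply/is_upper_mxP => i j ji; rewrite mxE uc.
Qed.

Lemma mem_perm_image w k i : (i \in perm_image w k) = (w^-1%g i < k)%N.
Proof.
apply/imsetP/idP => [[j]|]; first by rewrite inE => jk ->; rewrite permK.
by move=> ik; exists (w^-1%g i); rewrite ?inE// permKV.
Qed.

Lemma card_perm_image w k : (k <= n)%N -> #|perm_image w k| = k.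
Proof.
move=> kn; rewrite card_imset; last exact: perm_inj.
rewrite -sum1_card; under eq_bigl do rewrite inE.
by rewrite (big_ord_narrow kn)/= sum1_card card_ord.
Qed.

Lemma sorted_enum_set I : sorted ltn [seq val i | i <- enum I].
Proof.
rewrite sorted_map {1}/enum_mem -enumT.
rewrite (sorted_filter (leT := relpre val ltn)) //; first by move=> x y z; exact: ltn_trans.
by rewrite -sorted_map val_enum_ord iota_ltn_sorted.
Qed.

Lemma enum_val_ltn I (x y : 'I_#|I|) : (x < y)%N -> (enum_val x < enum_val y)%N.
Proof.
move=> xy; pose z := enum_val x.
rewrite !(enum_val_nth z) -!(nth_map z (val z) val) -?cardE ?ltn_ord//.
by apply: (sorted_ltn_nth ltn_trans (val z) (sorted_enum_set I) _ _ _ _ xy);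
  rewrite inE size_map -cardE.
Qed.

(** Take for [c] the entry of [s] at the first position where the lists differ: past the common
    prefix, all entries of [t] exceed it. This turns lexicographic comparison into counting. *)
Lemma lexi_lt_count (s t : seq nat) : sorted ltn t -> size s = size t ->
  ((s : seqlexi nat) < (t : seqlexi nat))%O ->
  exists c, (count (fun x => x <= c)%N t < count (fun x => x <= c)%N s)%N.
Proof.
elim: s t => [|x s IHs] [|y t]//= ty [st].
rewrite Order.SeqLexiOrder.ltEseqlexi => /andP[].
rewrite leEnat; case: ltngtP => // [xy _ _|-> _ /= /IHs[]//].
  exists x; rewrite leqnn [(y <= x)%N]leqNgt xy/= add0n.
  apply: leq_ltn_trans (leq_addr _ _).
  rewrite leqn0 -leqn0 leqNgt -has_count; apply/hasPn => z zt; rewrite -ltnNge.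
  by apply: ltn_trans xy _; have /allP := order_path_min ltn_trans ty; exact.
- exact: path_sorted ty.
- by move=> c Hc; exists c; rewrite ltn_add2l.
Qed.

Lemma count_enum_set I c :
  count (fun x => x <= c)%N [seq val i | i <- enum I] = #|[set i in I | (i <= c)%N]%SET|.
Proof.
rewrite count_map -size_filter cardE; congr size.
rewrite {1}/enum_mem -filter_predI {1}/enum_mem; apply: eq_filter => i.
by rewrite !inE /= andbC.
Qed.

Lemma lex_lt_card I K : #|I| = #|K| -> lex_lt K I ->
  exists c : nat, (#|[set i in I | (i <= c)%N]%SET| < #|[set i in K | (i <= c)%N]%SET|)%N.
Proof.
move=> IK /lexi_lt_count[]; rewrite ?size_map -?cardE//; first exact: sorted_enum_set.
by move=> c; rewrite !count_enum_set; exists c.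
Qed.

Lemma lex_total I K : [\/ lex_lt I K, I = K | lex_lt K I].
Proof.
rewrite /lex_lt; case: ltgtP => [||e]; [by constructor 1|by constructor 3|].
constructor 2; apply/setP => i.
by rewrite -mem_enum -[RHS]mem_enum (inj_map val_inj e).
Qed.

(** A nonzero Leibniz term matches every row [i] in [I] to a column [j] with [i <= w j]. So for each
    [c] at least as many elements of [I] as of [w([k])] are at most [c], contrary to
    [lex_lt_card]. *)
Lemma minor_borel_lex b A w k I : borel b -> (forall i j, i != w j -> A i j = 0) ->
  #|I| = k -> lex_lt (perm_image w k) I -> minor I (b *m A) = 0.
Proof.
move=> /borelP[/is_upper_mxP ub _] Aw Ik lI.
have kn : (k <= n)%N by rewrite -Ik card_set_ord.
have [|c] := lex_lt_card _ lI; first by rewrite card_perm_image.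
rewrite ltnNge => /negP cI.
rewrite /minor /determinant big1// => s _; apply/eqP; rewrite mulf_eq0; apply/orP; right.
set wd := widen_ord _; apply: contraT => /prodf_neq0 ps.
have le (x : 'I_#|I|) : (enum_val x <= w (wd (s x)))%N.
  have := ps x isT; rewrite !mxE; apply: contra_neqT; rewrite -ltnNge => lx.
  rewrite big1// => z _; have [->|zw] := eqVneq z (w (wd (s x))).
    by rewrite ub// mul0r.
  by rewrite Aw// mulr0.
exfalso; apply: cI.
(* Compare through the set of rows matched to elements at most [c]: it covers those elements of
   [w([k])], and by [le] it lands in the part of [I] up to [c]. *)
apply: (@leq_trans #|[set x : 'I_#|I| | (w (wd (s x)) <= c)%N]%SET|).
  apply: leq_trans (leq_imset_card (fun x => w (wd (s x))) _); apply: subset_leq_card.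
  apply/fintype.subsetP => i; rewrite inE mem_perm_image => /andP[ik ic].
  rewrite -Ik in ik.
  apply/imsetP; have e : w (wd (s (s^-1%g (Ordinal ik)))) = i.
    by rewrite permKV; apply: (perm_inj (s := w^-1%g)); rewrite permK; exact: val_inj.
  by exists (s^-1%g (Ordinal ik)); rewrite ?inE e.
rewrite -(card_imset _ enum_val_inj); apply: subset_leq_card.
apply/fintype.subsetP => z /imsetP[x xc ->]; rewrite inE in xc.
by rewrite inE enum_valP (leq_trans (le x) xc).
Qed.

(** The first [k] columns of [A] live in the rows [w([k])], so the Cauchy-Binet sum has a single
    term, with the principal minor of [b] on [w([k])]. Increasing enumeration keeps that block
    triangular. *)
Lemma minor_borel_perm_image b A w k : (k <= n)%N -> borel b ->
  (forall i j, i != w j -> A i j = 0) ->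
  minor (perm_image w k) (b *m A) =
    (\prod_(j < n | (j < k)%N) b (w j) (w j)) * minor (perm_image w k) A.
Proof.
move=> kn /borelP[/is_upper_mxP ub _] Aw; set I := perm_image w k.
pose ev := fun i : 'I_#|I| => enum_val i; set wd := widen_ord (card_set_ord I).
have Ik : #|I| = k by exact: card_perm_image.
have -> : minor I (b *m A) = \det (mxsub ev ev b *m mxsub ev wd A).
  congr (\det _); apply/matrixP => x y; rewrite !mxE.
  have wI : w (wd y) \in I by rewrite mem_perm_image permK/= -[X in (_ < X)%N]Ik.
  rewrite (bigD1 (w (wd y)))//= big1 => [|z zw]; last by rewrite Aw// mulr0.
  rewrite (bigD1 (enum_rank_in wI (w (wd y))))//= big1 => [|z].
    by rewrite !mxE /ev enum_rankK_in.
  apply: contra_neqP => /eqP; rewrite !mxE mulf_eq0 negb_or => /andP[_].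
  apply: contraNeq => zx; rewrite Aw//; apply: contra_neq zx => e.
  by rewrite -[LHS](enum_valK_in wI) -[enum_val z]/(ev z) e.
rewrite det_mulmx; congr (_ * _); rewrite det_upper.
  under eq_bigr do rewrite mxE.
  rewrite -(@big_enum_val _ _ _ _ (mem I) (fun i => b i i)) big_imset/=.
    by apply: eq_bigl => j; rewrite inE.
  by move=> ? ? _ _; exact: perm_inj.
by apply/is_upper_mxP => x y /enum_val_ltn xy; rewrite mxE ub.
Qed.

(** The submatrix is itself a signed permutation matrix, hence orthogonal. *)
Lemma minor_signed_perm_sqr A w k : (k <= n)%N ->
  (forall i j, i != w j -> A i j = 0) -> (forall j, A (w j) j ^+ 2 = 1) ->
  minor (perm_image w k) A ^+ 2 = 1.
Proof.
move=> kn Aw A1; set I := perm_image w k.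
have Ik : #|I| = k by exact: card_perm_image.
set wd := widen_ord (card_set_ord I).
rewrite expr2 /minor -{1}det_tr -det_mulmx -[RHS](det1 _ #|I|); congr (\det _).
apply/matrixP => y y'; rewrite !mxE.
have wI : w (wd y) \in I by rewrite mem_perm_image permK/= -[X in (_ < X)%N]Ik.
rewrite (bigD1 (enum_rank_in wI (w (wd y))))//= big1 ?addr0 => [|z zx].
  rewrite !mxE enum_rankK_in//; have [->|yy'] := eqVneq y y'; first by rewrite -expr2 A1.
  rewrite -/wd [X in _ * X]Aw ?mulr0//.
  apply: contra_neq yy' => /perm_inj/(congr1 val)/= yy'.
  exact: val_inj.
rewrite !mxE Aw ?mul0r//; apply: contra_neq zx => e.
by rewrite -[LHS](enum_valK_in wI) e.
Qed.

(** Some column of the submatrix has its only possible nonzero entry outside the rows [I]. *)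
Lemma minor_signed_perm_eq0 A w I : (forall i j, i != w j -> A i j = 0) ->
  I != perm_image w #|I| -> minor I A = 0.
Proof.
move=> Aw; have In := card_set_ord I.
have [/existsP[y yI] _|/existsPn sub] :=
    boolP [exists y : 'I_#|I|, w (widen_ord (card_set_ord I) y) \notin I].
  rewrite /minor (expand_det_col _ y) big1// => x _; rewrite !mxE Aw ?mul0r//.
  by apply: contraNneq yI => <-; exact: enum_valP.
rewrite eq_sym eqEcard card_perm_image// leqnn andbT => /negP[].
apply/fintype.subsetP => i; rewrite mem_perm_image => iI.
have := sub (Ordinal iI); rewrite negbK; set j := widen_ord _ _.
suff -> : w j = i by [].
by apply: (perm_inj (s := w^-1%g)); rewrite permK; exact: val_inj.
Qed.

Lemma exists_signed_perm w : exists A : M, signed_perm_mx w A.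
Proof.
pose P : M := \matrix_(i, j) (i == w j)%:R.
have Pw i j : i != w j -> P i j = 0 by move=> /negPf ij; rewrite mxE ij.
pose e k := minor (perm_image w k) P.
have e1 k : (k <= n)%N -> e k ^+ 2 = 1.
  move=> kn; apply: minor_signed_perm_sqr => // j.
  by rewrite mxE eqxx expr1n.
have e0 : e 0%N = 1.
  rewrite /e /minor; move: (fun i => enum_val i) (widen_ord _).
  by rewrite card_perm_image// => f f'; rewrite det_mx00.
(* These column signs telescope: the first [k] of them multiply to [e k], the minor of [P] on
   [w([k])], which turns that minor into [e k ^+ 2 = 1]. *)
pose d : 'rV[R[i]]_n := \row_j (e j * e j.+1).
have PdE i j : (P *m diag_mx d) i j = P i j * d 0 j by rewrite mul_mx_diag mxE.
have de k : (k <= n)%N -> \prod_(j < n | (j < k)%N) d 0 j = e k.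
  move=> kn; rewrite (big_ord_narrow kn).
  under eq_bigr do rewrite mxE/=.
  elim: k kn => [|k IHk] kn; first by rewrite big_ord0 e0.
  rewrite big_ord_recr/= (IHk (ltnW kn)) mulrA -expr2 e1 ?mul1r//.
  exact: ltnW.
exists (P *m diag_mx d); split.
- by move=> i j ij; rewrite PdE Pw// mul0r.
- move=> j; rewrite PdE !mxE eqxx mul1r.
  have /eqP : (e j * e j.+1) ^+ 2 = 1 ^+ 2 by rewrite expr1n exprMn !e1 ?mulr1// ltnW.
  by rewrite eqf_sqr => /orP[]/eqP; [left|right].
- move=> I; rewrite minor_mul_upper; last first.
    by apply/is_upper_mxP => i j ji; rewrite mxE -val_eqE (gtn_eqF ji).
  have -> : \prod_(j < n | (j < #|I|)%N) (diag_mx d) j j = e #|I|.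
    by rewrite -de ?card_set_ord//; apply: eq_bigr => j _; rewrite mxE eqxx.
  have [->|IK] := eqVneq I (perm_image w #|I|).
    rewrite card_perm_image ?card_set_ord// -/(e #|I|) -expr2 e1 ?card_set_ord//.
  by rewrite (minor_signed_perm_eq0 Pw IK) mul0r.
Qed.

End Minors.

(** * The Bruhat decomposition and the twist map *)

Section Bruhat.
Variables (R : realType) (n : nat).
Local Notation M := 'M[R[i]]_n.
Implicit Types (b c g G : M).

(** Invariant of the elimination: the first [m] columns and their pivot rows are unit vectors. Rows
    and columns are both recorded because each step operates on both sides. *)
Definition partial_perm_mx (m : nat) G : Prop :=
  exists f : 'I_n -> 'I_n, forall j : 'I_n, (j < m)%N ->
    (forall i, G i j = (i == f j)%:R) /\ (forall k, G (f j) k = (k == j)%:R).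

(** Upper triangular factors can clear a column above its pivot from the left, and a row to the
    right of its pivot from the right. *)
Lemma partial_perm_mx_step m G : (m < n)%N -> G \in unitmx ->
  partial_perm_mx m G ->
  exists b c, [/\ borel b, borel c & partial_perm_mx m.+1 (b *m G *m c)].
Proof.
move=> mn Gu [f Gf]; pose q := Ordinal mn.
have [i0 Gi0] : exists i, G i q != 0.
  apply/existsP; apply: contraLR Gu => /existsPn G0.
  rewrite unitmxE unitfE negbK (expand_det_col _ q) big1// => i _.
  by have /negPn/eqP -> := G0 i; rewrite mul0r.
(* The pivot is the lowest nonzero entry of the column, so only entries above it remain to be
   cleared. *)
pose p := [arg max_(i > i0 | G i q != 0) i].
have [Gp pmax] : G p q != 0 /\ forall i, G i q != 0 -> (i <= p)%N.
  by rewrite /p; case: arg_maxnP.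
have Glow (i : 'I_n) : (p < i)%N -> G i q = 0.
  by move=> pi; apply/eqP; apply: contraTT pi => /pmax; rewrite -leqNgt.
(* [b] differs from the identity only in column [p]: it makes the pivot one and subtracts multiples
   of row [p] from the rows above. [c] differs only in row [q] and subtracts multiples of column [q]
   from the columns to its right. *)
pose b : M := \matrix_(i, k)
  ((i == k)%:R - (G i q - (i == p)%:R) / G p q * (k == p)%:R).
pose z j := G p j / G p q.
pose c : M := \matrix_(k, j) ((k == j)%:R - (k == q)%:R * (z j - (j == q)%:R)).
have bG i j : (b *m G) i j = G i j - (G i q - (i == p)%:R) * z j.
  rewrite mxE; under eq_bigr do rewrite mxE mulrBl.
  rewrite sumrB (bigD1 i)//= eqxx mul1r big1 ?addr0 => [|k /negPf]; last first.
    by rewrite eq_sym => ->; rewrite mul0r.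
  rewrite (bigD1 p)//= eqxx mulr1 big1 ?addr0 => [|k /negPf->]; last by rewrite mulr0 mul0r.
  by rewrite /z mulrAC -!mulrA.
have bGq i : (b *m G) i q = (i == p)%:R by rewrite bG /z divff// mulr1 subKr.
have bGc i j : (b *m G *m c) i j =
    G i j - (G i q - (i == p)%:R) * z j - (i == p)%:R * (z j - (j == q)%:R).
  rewrite mxE; under eq_bigr do rewrite [c _ _]mxE mulrBr.
  rewrite sumrB (bigD1 j)//= eqxx mulr1 big1 ?addr0 => [|k /negPf->]; last by rewrite mulr0.
  rewrite (bigD1 q)//= eqxx mul1r big1 ?addr0 => [|k /negPf->]; last by rewrite mul0r mulr0.
  by rewrite bG bGq.
(* Earlier pivot rows vanish in column [q], so [p] is a new row and the earlier columns vanish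
   there. This makes [c] triangular and preserves the earlier pivots. *)
have Gfq (j : 'I_n) : (j < m)%N -> G (f j) q = 0.
  by move=> /[dup] jm /Gf[_ ->]; rewrite -val_eqE (gtn_eqF jm).
have fp (j : 'I_n) : (j < m)%N -> (f j == p) = false.
  by move=> jm; apply: contraNF Gp => /eqP <-; rewrite Gfq.
have z0 (j : 'I_n) : (j < m)%N -> z j = 0.
  by move=> jm; rewrite /z (Gf _ jm).1 eq_sym fp// mul0r.
exists b, c; split.
- apply/borelP; split.
    apply/is_upper_mxP => i k ki; rewrite mxE -val_eqE (gtn_eqF ki) sub0r.
    have [kp|] := eqVneq k p; last by rewrite mulr0 oppr0.
    rewrite kp in ki; rewrite Glow// -val_eqE (gtn_eqF ki).
    by rewrite subr0 !mul0r oppr0.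
  move=> i; rewrite mxE eqxx; have [->|_] := eqVneq i p.
    by rewrite mulr1 mulrBl mul1r divff// subKr invr_eq0.
  by rewrite mulr0 subr0 oner_eq0.
- apply/borelP; split.
    apply/is_upper_mxP => k j jk; rewrite mxE -val_eqE (gtn_eqF jk) sub0r.
    have [kq|] := eqVneq k q; last by rewrite mul0r oppr0.
    rewrite kq in jk; rewrite z0// -val_eqE (ltn_eqF jk).
    by rewrite subr0 mulr0 oppr0.
  move=> i; rewrite mxE eqxx; have [->|_] := eqVneq i q.
    by rewrite /z divff// subrr mulr0 subr0 oner_eq0.
  by rewrite mul0r subr0 oner_eq0.
- exists (fun j => if j == q then p else f j) => j.
  rewrite ltnS leq_eqVlt => /orP[jq|jm].
    have -> : j = q by apply: val_inj; exact/eqP.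
    rewrite eqxx; split=> [i|k]; rewrite bGc ?eqxx /z.
      by rewrite divff// subrr mulr0 subr0 mulr1 subKr.
    rewrite -{1}[G p k](divfK Gp); move: (G p k / G p q) (G p q) (_ == q)%:R => y x e.
    rewrite -[true%:R]/(1 : R[i]) mulrC mulrBl !mul1r subKr; exact: subKr.
  have jq : (j == q) = false by rewrite -val_eqE (ltn_eqF jm).
  rewrite jq; split=> [i|k]; rewrite bGc.
    by rewrite jq z0// mulr0 !subr0 mulr0 subr0 (Gf _ jm).1.
  by rewrite Gfq// fp// subr0 !mul0r !subr0 (Gf _ jm).2.
Qed.

Lemma partial_perm_mx_borel m g : (m <= n)%N -> g \in unitmx ->
  exists b c, [/\ borel b, borel c & partial_perm_mx m (b *m g *m c)].
Proof.
elim: m => [|m IHm] mn gu.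
  by exists 1%:M, 1%:M; split; [exact: borel1|exact: borel1|exists id].
have [b [c [bb bc P]]] := IHm (ltnW mn) gu.
have [|b' [c' [bb' bc' P']]] := partial_perm_mx_step mn _ P.
  by rewrite !unitmx_mul gu bb.1 bc.1.
exists (b' *m b), (c *m c'); split; [exact: borel_mul|exact: borel_mul|].
by rewrite !mulmxA in P' *.
Qed.

(** Eliminating all [n] columns leaves a permutation matrix; it differs from the signed one by
    column signs [d], which go into the right factor. *)
Lemma bruhat g : g \in unitmx -> exists w b A c,
  [/\ borel b, signed_perm_mx w A, borel c & g = b *m A *m c].
Proof.
move=> gu; have [b [c [bb bc [f Gf]]]] := partial_perm_mx_borel (leqnn n) gu.
have finj : injective f.
  move=> j k fjk; have [] := Gf j (ltn_ord j) => _ /(_ j); rewrite eqxx fjk.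
  rewrite (Gf k (ltn_ord k)).2; case: eqP => // _ /eqP.
  by rewrite eq_sym oner_eq0.
pose w := perm finj; have [A Aw] := exists_signed_perm R w.
have [A0 A1 _] := Aw.
pose d : 'rV[R[i]]_n := \row_j A (w j) j.
have d1 j : d 0 j * d 0 j = 1 by rewrite mxE; case: (A1 j) => ->; rewrite ?mulrNN mulr1.
have e : b *m g *m c = A *m diag_mx d.
  apply/matrixP => i j; rewrite (Gf j (ltn_ord j)).1 mul_mx_diag mxE.
  have [->|ij] := eqVneq i (f j); last by rewrite A0 ?mul0r// permE.
  by rewrite -(d1 j) [X in X * _ = _]mxE permE.
exists w, (invmx b), A, (diag_mx d *m invmx c); split => //.
- exact: borel_inv.
- apply: borel_mul; last exact: borel_inv.
  apply: borel_diag => i; apply: contraTneq (oner_neq0 R[i]) => di.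
  by rewrite -(d1 i) di mul0r eqxx.
- by rewrite mulmxA -(mulmxA _ A) -e -!mulmxA mulKmx ?bb.1// mulmxV ?bc.1// mulmx1.
Qed.

End Bruhat.

(** * Canonical representatives of flags *)

Section CanonicalRepresentative.
Variables (R : realType) (n : nat).
Local Notation M := 'M[R[i]]_n.
Implicit Types (b c g h : M) (V : set M).

Lemma flag_of_mul g c : borel c -> flag_of (g *m c) = flag_of g.
Proof.
move=> bc; apply/seteqP; split=> h [b bb ->].
  by exists (c *m b); rewrite ?mulmxA//; exact: borel_mul.
exists (invmx c *m b); first exact: borel_mul (borel_inv bc) bb.
by rewrite -mulmxA mulKVmx// bc.1.
Qed.

Lemma flag_of_eq g h : flag_of g = flag_of h -> exists2 b, borel b & h = g *m b.
Proof.
move=> gh; suff : flag_of g h by [].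
by rewrite gh; exists 1%:M; [exact: borel1|rewrite mulmx1].
Qed.

(** The change of basis is unitary and lies in the Borel subgroup, hence is a diagonal matrix of
    phases. *)
Lemma flag_of_eq_unitary g h : g \is unitarymx -> h \is unitarymx ->
  flag_of g = flag_of h ->
  exists2 d : 'rV_n, h = g *m diag_mx d & forall i, `|d 0 i| = 1.
Proof.
move=> ug uh /flag_of_eq[b bb hb].
have [|d bd d1] := unitary_borel_diag _ bb; last by exists d; rewrite -?bd.
have -> : b = invmx g *m h by rewrite hb (mulKmx (unitarymx_unit ug)).
rewrite (invmx_unitary ug); apply: mul_unitarymx; last exact: uh.
rewrite trmxC_unitary; exact: ug.
Qed.

(** With [h = g *m diag_mx d] for phases [d], minors change by partial products of [d]. The sets
    [w([k])], being lexicographically largest with nonzero minor, agree for both, so all partial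
    products are positive; and a positive phase is one. *)
Lemma is_canonical_rep_uniq V g h :
  is_canonical_rep V g -> is_canonical_rep V h -> g = h.
Proof.
move=> [ug Vg [w _ wg]] [uh Vh [w' _ wh]].
have [|d hd d1] := flag_of_eq_unitary ug uh; first by rewrite -Vg.
have ud : is_upper_mx (diag_mx d).
  by apply/is_upper_mxP => i j ji; rewrite mxE -val_eqE (gtn_eqF ji).
have d0 i : d 0 i != 0 by rewrite -normr_gt0 d1.
have hg I : minor I h = minor I g * \prod_(j < n | (j < #|I|)%N) d 0 j.
  rewrite hd minor_mul_upper//; congr (_ * _).
  by apply: eq_bigr => j _; rewrite mxE eqxx mulr1n.
have hg0 I : (minor I h == 0) = (minor I g == 0).
  rewrite hg mulf_eq0 orbC; case: eqP => //= /eqP/prodf_eq0[j _].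
  by rewrite (negPf (d0 j)).
have ww' k : (1 <= k <= n)%N -> perm_image w k = perm_image w' k.
  move=> /[dup] /andP[_ kn] k1n.
  have [lt||lt] := lex_total (perm_image w k) (perm_image w' k) => //.
    have := (wg k k1n).2 _ (card_perm_image _ kn) lt => /eqP.
    by rewrite -hg0 gt_eqF ?(wh k k1n).1.
  have := (wh k k1n).2 _ (card_perm_image _ kn) lt => /eqP.
  by rewrite hg0 gt_eqF ?(wg k k1n).1.
have pd k : (k <= n)%N -> 0 < \prod_(j < n | (j < k)%N) d 0 j.
  case: k => [_|k kn]; first by rewrite big_pred0 ?ltr01.
  have := (wh k.+1 kn).1; rewrite -ww'// hg card_perm_image// pmulr_rgt0//.
  exact: (wg k.+1 kn).1.
have dpos i : 0 < d 0 i.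
  have := pd i.+1 (ltn_ord i); rewrite (bigD1 i)//= pmulr_lgt0//.
  rewrite (eq_bigl (fun j : 'I_n => (j < i)%N)); first exact: pd (ltnW (ltn_ord i)).
  by move=> j; rewrite -val_eqE /= ltnS ltn_neqAle andbC.
suff -> : h = g by [].
rewrite hd -[RHS]mulmx1 -diag_const_mx; congr (_ *m diag_mx _).
by apply/rowP => i; rewrite mxE -(d1 i) gtr0_norm.
Qed.

(** Sufficient for being canonical, and easier to follow along a flow than the minors: the
    positivity condition survives upper triangular factors with positive diagonal on either side. *)
Definition positive_bruhat g : Prop := g \is unitarymx /\
  exists w b A c, [/\ borel b, signed_perm_mx w A, borel c, g = b *m A *m c
                    & forall j, 0 < b (w j) (w j) * c j j].

(** The minor on [w([k])] is the product of the positive numbers [b (w j) (w j) * c j j], [j < k],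
    times a minor of [A] that is nonnegative with square one. *)
Lemma positive_bruhat_canonical g :
  positive_bruhat g -> is_canonical_rep (flag_of g) g.
Proof.
move=> [ug [w [b [A [c [bb Aw bc gE bc0]]]]]]; split => //; exists w.
  by exists b, A; split=> //; rewrite gE flag_of_mul.
have [A0 A1 Am] := Aw; have [uc _] := (borelP c).1 bc.
move=> k /andP[k0 kn]; split=> [|I Ik lI].
  rewrite gE minor_mul_upper// minor_borel_perm_image// card_perm_image//.
  rewrite mulrAC -big_split/= mulr_gt0 ?prodr_gt0// lt_neqAle Am andbT.
  have mA : minor (perm_image w k) A ^+ 2 = 1.
    by apply: minor_signed_perm_sqr => // j; case: (A1 j) => ->; rewrite ?sqrrN expr1n.
  by rewrite eq_sym -sqrf_eq0 mA oner_eq0.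
by rewrite gE minor_mul_upper// (minor_borel_lex bb A0 Ik lI) mul0r.
Qed.

Lemma canonical_rep_positive_bruhat g :
  positive_bruhat g -> canonical_rep (flag_of g) = g.
Proof.
move=> /positive_bruhat_canonical cg; apply: xget_unique => // h ch.
exact: is_canonical_rep_uniq ch cg.
Qed.

Lemma diag_unitary (d : 'rV[R[i]]_n) :
  (forall i, `|d 0 i| = 1) -> diag_mx d \is unitarymx.
Proof.
move=> d1; apply/unitarymxP/matrixP => i j; rewrite mul_diag_mx !mxE.
have [->|_] := eqVneq i j; last by rewrite conjC0 mulr0.
by rewrite mulr1n -normCK d1 expr1n.
Qed.

(** Multiplying column [j] by the conjugate phase of [b (w j) (w j) * c j j] replaces this number by
    its modulus. *)
Lemma exists_positive_bruhat g : g \is unitarymx ->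
  exists2 d : 'rV[R[i]]_n, positive_bruhat (g *m diag_mx d)
                         & forall i, `|d 0 i| = 1.
Proof.
move=> ug; have [w [b [A [c [bb Aw bc gE]]]]] := bruhat (unitarymx_unit ug).
have [[_ b0] [uc c0]] := ((borelP b).1 bb, (borelP c).1 bc).
pose a j := b (w j) (w j) * c j j.
have a0 j : a j != 0 by rewrite mulf_neq0.
pose d : 'rV[R[i]]_n := \row_j (`|a j| / a j).
have d1 i : `|d 0 i| = 1 by rewrite mxE normrM normr_id normfV divff// normr_eq0.
exists d; last exact: d1.
split; first by apply: mul_unitarymx; [exact: ug|exact: diag_unitary].
exists w, b, A, (c *m diag_mx d); split=> //.
- apply: borel_mul => //; apply: borel_diag => i.
  by rewrite -normr_gt0 d1.
- by rewrite gE !mulmxA.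
- move=> j; rewrite mul_mx_diag mxE mulrA -/(a j) mxE mulrC divfK//.
  by rewrite normr_gt0.
Qed.

End CanonicalRepresentative.

(** * The twist map on the orbit, in terms of unitary frames *)

Section OrbitTwist.
Variables (R : realType) (n : nat) (lambda : 'rV[R]_n).
Hypothesis lambda_decr : forall i j : 'I_n, (i < j)%N -> lambda 0 j < lambda 0 i.
Local Notation M := 'M[R[i]]_n.
Implicit Types (g h : M).

Lemma lambda_eq i j : (lambda 0 i == lambda 0 j) = (i == j).
Proof.
have [->|] := eqVneq i j; first by rewrite eqxx.
rewrite neq_ltn => /orP[ij|ij]; first by rewrite gt_eqF ?lambda_decr.
by rewrite lt_eqF ?lambda_decr.
Qed.

Lemma orbit_point_mul_diag g (d : 'rV[R[i]]_n) : g \in unitmx ->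
  (forall i, d 0 i != 0) ->
  orbit_point lambda (g *m diag_mx d) = orbit_point lambda g.
Proof.
move=> gu d0; have [du _] := borel_diag d0.
rewrite /orbit_point /i_diag -(mulmxA g) diag_mxC mulmxA.
have -> : invmx (g *m diag_mx d) = invmx (diag_mx d) *m invmx g.
  apply: (can_inj (mulKmx (_ : g *m diag_mx d \in unitmx))).
    by rewrite unitmx_mul gu du.
  by rewrite mulmxV ?unitmx_mul ?gu// mulmxA mulmxK// mulmxV.
by rewrite mulmxA mulmxK.
Qed.

Lemma flag_to_orbitE g : g \is unitarymx ->
  flag_to_orbit lambda (flag_of g) = orbit_point lambda g.
Proof.
move=> ug; apply: xget_unique; first by exists g.
move=> _ [h [uh gh ->]]; have [d -> d1] := flag_of_eq_unitary ug uh gh.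
by rewrite (orbit_point_mul_diag (unitarymx_unit ug)) => // i; rewrite -normr_gt0 d1.
Qed.

(** The matrix [invmx g *m h] commutes with a diagonal matrix with distinct entries, so it is
    diagonal and lies in the Borel subgroup. *)
Lemma orbit_point_inj_flag g h : g \is unitarymx -> h \is unitarymx ->
  orbit_point lambda g = orbit_point lambda h -> flag_of g = flag_of h.
Proof.
move=> ug uh e; have [gu hu] := (unitarymx_unit ug, unitarymx_unit uh).
pose c := invmx g *m h.
have cu : c \in unitmx by rewrite unitmx_mul unitmx_inv gu.
have ec : i_diag lambda *m c = c *m i_diag lambda.
  have /(congr1 (fun X => invmx g *m X *m h)) := e.
  rewrite /orbit_point !mulmxA (mulVmx gu) mul1mx -!mulmxA (mulVmx hu) mulmx1.
  exact: id.
have cd i j : i != j -> c i j = 0.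
  move=> ij; have /matrixP/(_ i j) := ec.
  rewrite mul_diag_mx mul_mx_diag !mxE => /eqP; rewrite mulrC -subr_eq0 -mulrBr.
  rewrite -mulrBr mulf_eq0 => /orP[/eqP//|].
  rewrite mulf_eq0 (negPf (neq0Ci _))/= subr_eq0 => /eqP/complexI/eqP.
  by rewrite lambda_eq (negPf ij).
have -> : h = g *m c by rewrite mulmxA (mulmxV gu) mul1mx.
rewrite flag_of_mul//; split=> //; apply/is_upper_mxP => i j ji.
by rewrite cd// -val_eqE (gtn_eqF ji).
Qed.

Lemma orbit_to_flagE g : g \is unitarymx ->
  orbit_to_flag lambda (orbit_point lambda g) = flag_of g.
Proof.
move=> ug; apply: xget_unique; first by exists g.
by move=> _ [h [uh gh ->]]; exact/esym/orbit_point_inj_flag.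
Qed.

Lemma delta_unitary : delta R n \is unitarymx.
Proof. by apply: diag_unitary => i; rewrite mxE normrX normrN1 expr1n. Qed.

Lemma iota_unitary g : g \is unitarymx -> Defs.iota g \is unitarymx.
Proof.
move=> ug; rewrite /Defs.iota (invmx_unitary ug).
apply: mul_unitarymx; last exact: delta_unitary.
by apply: mul_unitarymx; [exact: delta_unitary|rewrite trmxC_unitary].
Qed.

(** Every [xget] in the definition of the twist has exactly one candidate here, so only the explicit
    formula remains. *)
Lemma twist_orbitE g : positive_bruhat g ->
  twist_orbit lambda (orbit_point lambda g) = orbit_point lambda (Defs.iota g).
Proof.
move=> /[dup] pg [ug _].
rewrite /twist_orbit (orbit_to_flagE ug) /twist (canonical_rep_positive_bruhat pg).
exact/flag_to_orbitE/iota_unitary.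
Qed.

Lemma adjoint_orbit_positive_bruhat (L : M) : adjoint_orbit lambda L ->
  exists2 g, positive_bruhat g & L = orbit_point lambda g.
Proof.
move=> [g ug ->]; have [d pg d1] := exists_positive_bruhat ug.
exists (g *m diag_mx d); first exact: pg.
by rewrite (orbit_point_mul_diag (unitarymx_unit ug)) => // i; rewrite -normr_gt0 d1.
Qed.

End OrbitTwist.

(** * Metrics on the adjoint orbit *)

Section SchurMultipliers.
Variables (C : numClosedFieldType) (n : nat) (h : 'M[C]_n).
Hypothesis uh : h \is unitarymx.
Local Open Scope sesquilinear_scope.
Local Notation M := 'M[C]_n.
Implicit Types (X Y : M) (phi psi : 'I_n -> 'I_n -> C).

Definition coords X : M := h ^t* *m X *m h.

(** In a frame [h] diagonalising [L], the operator ad_L, the root of -ad_L^2 and the projection onto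
    the image of ad_L all have this form, so identities between them reduce to scalars. *)
Definition schur phi X : M :=
  h *m (\matrix_(j, k) (phi j k * coords X j k)) *m h ^t*.

Lemma unitary_mulJ : h ^t* *m h = 1%:M.
Proof. by rewrite -(invmx_unitary uh) (mulVmx (unitarymx_unit uh)). Qed.

Lemma coordsK X : h *m coords X *m h ^t* = X.
Proof.
have /unitarymxP hJ := uh.
by rewrite /coords !mulmxA hJ mul1mx -mulmxA hJ mulmx1.
Qed.

Lemma coords_inj X Y : (forall j k, coords X j k = coords Y j k) -> X = Y.
Proof.
move=> XY; rewrite -(coordsK X) -(coordsK Y); congr (_ *m _ *m _).
exact/matrixP.
Qed.

Lemma coords_conj (Z : M) : coords (h *m Z *m h ^t*) = Z.
Proof. by rewrite /coords !mulmxA unitary_mulJ mul1mx -mulmxA unitary_mulJ mulmx1. Qed.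

Lemma coords_schur phi X j k : coords (schur phi X) j k = phi j k * coords X j k.
Proof. by rewrite coords_conj mxE. Qed.

Lemma coordsD X Y j k : coords (X + Y) j k = coords X j k + coords Y j k.
Proof. by rewrite /coords mulmxDr mulmxDl mxE. Qed.

Lemma coords0 j k : coords 0 j k = 0.
Proof. by rewrite /coords mulmx0 mul0mx mxE. Qed.

Lemma coordsN X j k : coords (- X) j k = - coords X j k.
Proof. by rewrite /coords mulmxN mulNmx mxE. Qed.

Lemma coordsZ a X j k : coords (a *: X) j k = a * coords X j k.
Proof. by rewrite /coords -scalemxAr -scalemxAl mxE. Qed.

Lemma trmxC_mul X Y : (X *m Y) ^t* = Y ^t* *m X ^t*.
Proof. by rewrite trmx_mul map_mxM. Qed.

Lemma coords_trmxC X j k : coords (X ^t*) j k = (coords X k j)^*.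
Proof.
have -> : coords (X ^t*) = (coords X)^t*.
  by rewrite /coords !trmxC_mul trmxCK mulmxA.
by rewrite !mxE.
Qed.

Lemma coords_commx (d : 'rV[C]_n) X j k :
  coords (h *m diag_mx d *m h ^t* *m X - X *m (h *m diag_mx d *m h ^t*)) j k =
  (d 0 j - d 0 k) * coords X j k.
Proof.
pose Z := coords X; have -> : X = h *m Z *m h ^t* by rewrite coordsK.
rewrite coordsD coordsN.
have mulh (A B : M) : (h *m A *m h ^t*) *m (h *m B *m h ^t*) = h *m (A *m B) *m h ^t*.
  by rewrite -!mulmxA (mulmxA (h ^t*)) unitary_mulJ mul1mx.
rewrite !mulh !coords_conj mul_diag_mx mul_mx_diag [X in X - _]mxE [X in _ - X]mxE mulrBl.
by congr (_ - _); rewrite mulrC.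
Qed.

Lemma schurM phi psi X : schur phi (schur psi X) = schur (fun j k => phi j k * psi j k) X.
Proof. by apply: coords_inj => j k; rewrite !coords_schur mulrA. Qed.

Lemma eq_schur phi psi X : phi =2 psi -> schur phi X = schur psi X.
Proof. by move=> e; apply: coords_inj => j k; rewrite !coords_schur e. Qed.


Lemma schur_linear phi a X Y : schur phi (a *: X + Y) = a *: schur phi X + schur phi Y.
Proof.
apply: coords_inj => j k.
by rewrite coords_schur !(coordsD, coordsZ) !coords_schur mulrDr mulrCA.
Qed.

Lemma schur1 X : schur (fun _ _ => 1) X = X.
Proof. by apply: coords_inj => j k; rewrite coords_schur mul1r. Qed.

Lemma schur_suml (I : finType) (phi : I -> 'I_n -> 'I_n -> C) X :
  schur (fun j k => \sum_i phi i j k) X = \sum_i schur (phi i) X.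
Proof.
rewrite /schur -mulmx_suml -mulmx_sumr; congr (_ *m _ *m _).
apply/matrixP => j k; rewrite summxE [LHS]mxE mulr_suml.
by apply: eq_bigr => i _; rewrite [RHS]mxE.
Qed.

Lemma mxtrace_schur_mul phi X Y :
  \tr (schur phi X *m Y) = \sum_j \sum_k phi j k * coords X j k * coords Y k j.
Proof.
rewrite /schur -mulmxA -mulmxA mxtrace_mulC -!mulmxA (mulmxA (h ^t*)) -/(coords Y).
by apply: eq_bigr => j _; rewrite mxE; apply: eq_bigr => k _; rewrite mxE.
Qed.

Lemma mxtrace_schur phi X : \tr (schur phi X) = \sum_j phi j j * coords X j j.
Proof.
rewrite /schur mxtrace_mulC mulmxA unitary_mulJ mul1mx.
by apply: eq_bigr => j _; rewrite mxE.
Qed.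

Local Notation ad A X := (A *m X - X *m A).

Lemma skew_coordsP X :
  X ^t* = - X <-> forall j k, (coords X k j)^* = - coords X j k.
Proof.
split=> [sX j k|sX]; first by rewrite -coords_trmxC sX coordsN.
by apply: coords_inj => j k; rewrite coords_trmxC sX coordsN.
Qed.

Lemma skew_schur phi X : (forall j k, (phi k j)^* = phi j k) ->
  X ^t* = - X -> (schur phi X) ^t* = - schur phi X.
Proof.
move=> phiJ /skew_coordsP sX; apply/skew_coordsP => j k.
by rewrite !coords_schur rmorphM/= phiJ sX mulrN.
Qed.

Variable l : 'I_n -> C.
Hypothesis l_inj : injective l.
Hypothesis l_real : forall j, l j \is Num.real.

(** [omega] gives the eigenvalues of ad_L, [gap] those of the positive root of -ad_L^2, and
    [offdiag] the projection onto the image of ad_L. *)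
Definition omega (j k : 'I_n) : C := 'i * (l j - l k).
Definition gap (j k : 'I_n) : C := `|l j - l k|.
Definition offdiag (j k : 'I_n) : C := (j != k)%:R.

Let L := h *m diag_mx (\row_j ('i * l j)) *m h ^t*.

Lemma omega_eq0 j k : (omega j k == 0) = (j == k).
Proof. by rewrite /omega mulf_eq0 (negPf (neq0Ci _))/= subr_eq0 (inj_eq l_inj). Qed.

Lemma omegaxx j : omega j j = 0.
Proof. by apply/eqP; rewrite omega_eq0. Qed.

Lemma omegaN j k : omega k j = - omega j k.
Proof. by rewrite /omega -mulrN opprB. Qed.

Lemma conj_omega j k : (omega k j)^* = omega j k.
Proof.
rewrite /omega rmorphM/= conjCi rmorphB/= !(CrealP _) ?l_real//.
by rewrite mulNr -mulrN opprB.
Qed.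

Lemma conj_gap j k : (gap k j)^* = gap j k.
Proof. by rewrite /gap distrC (CrealP _)// normr_real. Qed.

Lemma gap_sym j k : gap k j = gap j k. Proof. by rewrite /gap distrC. Qed.

Lemma gapxx j : gap j j = 0. Proof. by rewrite /gap subrr normr0. Qed.

Lemma conj_offdiag j k : (offdiag k j)^* = offdiag j k.
Proof. by rewrite /offdiag rmorph_nat eq_sym. Qed.

Lemma omega_sqr j k : omega j k * omega j k = - (gap j k * gap j k).
Proof.
by rewrite /omega mulrACA -expr2 sqrCi mulN1r -!expr2 real_normK// rpredB.
Qed.

Lemma coords_ad X j k : coords (ad L X) j k = omega j k * coords X j k.
Proof. by rewrite coords_commx !mxE -mulrBr. Qed.

Lemma skew_orbit : L ^t* = - L.
Proof.
apply/skew_coordsP => j k; rewrite /L coords_conj !mxE rmorphMn/= rmorphM/= conjCi.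
rewrite (CrealP (l_real _)) mulNr mulNrn eq_sym.
by have [->|] := eqVneq j k.
Qed.

(** Divide by the eigenvalues [omega]; they vanish only on the diagonal, where [phi] does too. *)
Lemma schur_in_im_ad phi X :
  (forall j k, (phi k j)^* = phi j k) -> (forall j, phi j j = 0) ->
  X ^t* = - X -> exists2 Y, Y ^t* = - Y & schur phi X = ad L Y.
Proof.
move=> phiJ phi0 sX; exists (schur (fun j k => phi j k / omega j k) X).
  by apply: skew_schur => // j k; rewrite rmorphM/= fmorphV/= phiJ conj_omega.
apply: coords_inj => j k; rewrite coords_ad !coords_schur mulrA.
have [->|jk] := eqVneq j k; first by rewrite phi0 !mul0r mulr0 mul0r.
by rewrite mulrCA divff ?mulr1// omega_eq0.
Qed.

(** ad_L is diagonal in these coordinates. Hence its image and kernel meet only in zero, which makes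
    X^L unique. *)
Lemma ad_sqr_eq0 X : ad L (ad L X) = 0 -> ad L X = 0.
Proof.
move=> LX0; apply: coords_inj => j k.
have /(congr1 (fun Z => coords Z j k)) := LX0.
rewrite !coords_ad coords0 => /eqP; rewrite mulf_eq0 omega_eq0.
by move=> /orP[/eqP ->|/eqP //]; rewrite omegaxx mul0r.
Qed.

Lemma ad_diag_part X : ad L (X - schur offdiag X) = 0.
Proof.
apply: coords_inj => j k; rewrite coords_ad coordsD coordsN coords_schur coords0.
have [->|jk] := eqVneq j k; first by rewrite omegaxx mul0r.
by rewrite /offdiag jk mul1r subrr mulr0.
Qed.

(** [omega] is invertible off the diagonal. This makes the normal metric independent of the [X]
    chosen to represent a tangent vector. *)
Lemma schur_offdiag_ad X Y : ad L X = ad L Y -> schur offdiag X = schur offdiag Y.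
Proof.
move=> XY; apply: coords_inj => j k; rewrite !coords_schur.
have [->|jk] := eqVneq j k; first by rewrite /offdiag eqxx !mul0r.
congr (_ * _); have := congr1 (fun Z => coords Z j k) XY.
by rewrite !coords_ad; apply: mulfI; rewrite omega_eq0.
Qed.

Lemma ad_sqr X : - ad L (ad L X) = schur gap (schur gap X).
Proof.
apply: coords_inj => j k.
by rewrite coordsN !coords_ad mulrA omega_sqr !coords_schur mulNr opprK mulrA.
Qed.

Lemma mxtrace_schur_gapC X Y : \tr (schur gap X *m Y) = \tr (X *m schur gap Y).
Proof.
rewrite [RHS]mxtrace_mulC !mxtrace_schur_mul exchange_big.
apply: eq_bigr => j _; apply: eq_bigr => k _.
by rewrite gap_sym -!mulrA [coords _ _ _ * _]mulrC.
Qed.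

Lemma mxtrace_schur_ge0 phi X : (forall j k, 0 <= phi j k) -> X ^t* = - X ->
  0 <= - \tr (schur phi X *m X).
Proof.
move=> phi0 /skew_coordsP sX; rewrite mxtrace_schur_mul.
rewrite -sumrN sumr_ge0// => j _; rewrite -sumrN sumr_ge0// => k _.
by rewrite -mulrA -mulrN mulr_ge0// -mulrN -sX mul_conjC_ge0.
Qed.

Lemma mxtrace_offdiag X : \tr (schur offdiag X) = 0.
Proof. by rewrite mxtrace_schur big1// => j _; rewrite /offdiag eqxx mul0r. Qed.

(** The square of [omega] is minus that of [gap]. Thus the root of -ad_L^2 maps the candidate
    gradient to a double commutator. *)
Lemma schur_gap_grad X : schur gap (schur (fun j k => - gap j k) X) = ad L (ad L X).
Proof.
apply: coords_inj => j k; rewrite !coords_schur !coords_ad [LHS]mulrA [RHS]mulrA.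
by rewrite omega_sqr mulrN.
Qed.

(** Invariance of the trace form under ad_L; diagonal coordinates may be dropped because [omega]
    vanishes there. *)
Lemma mxtrace_offdiag_ad X Y :
  \tr (schur offdiag (ad L X) *m schur offdiag Y) = - \tr (ad L Y *m X).
Proof.
rewrite -[X in _ = - \tr (X *m _)]schur1 !mxtrace_schur_mul exchange_big -sumrN.
apply: eq_bigr => j _; rewrite -sumrN; apply: eq_bigr => k _.
rewrite coords_schur !coords_ad mul1r.
have [->|jk] := eqVneq j k; first by rewrite omegaxx /offdiag eqxx !mul0r oppr0.
rewrite /offdiag jk eq_sym jk !mul1r omegaN !mulNr -!mulrA.
by rewrite [coords X _ _ * _]mulrC.
Qed.

(* Each pair of opposite coordinates [(j, k)], [(k, j)] occurs twice in the sum,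
   hence the halving in [phi]. *)
Lemma schur_gap_eigen X : X ^t* = - X ->
  exists Z : 'I_n * 'I_n -> M, [/\ X = \sum_p Z p,
    schur gap X = \sum_p gap p.1 p.2 *: Z p & forall p, (Z p) ^t* = - Z p /\
      - ad L (ad L (Z p)) = gap p.1 p.2 ^+ 2 *: Z p].
Proof.
move=> sX.
pose phi (p : 'I_n * 'I_n) (j k : 'I_n) : C :=
  (((j, k) == p)%:R + ((k, j) == p)%:R) / 2.
have phiJ p j k : (phi p k j)^* = phi p j k.
  by rewrite /phi rmorphM/= rmorphD/= fmorphV/= !rmorph_nat addrC.
have phi1 j k : \sum_p phi p j k = 1.
  rewrite /phi -mulr_suml big_split/=.
  have one (q : 'I_n * 'I_n) : \sum_p ((q == p)%:R : C) = 1.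
    by rewrite (bigD1 q)//= eqxx big1 ?addr0// => p; rewrite eq_sym => /negPf->.
  by rewrite !one -(natrD _ 1 1) divff// pnatr_eq0.
have gap_phi p j k : gap j k * phi p j k = gap p.1 p.2 * phi p j k.
  rewrite /phi; have [<- //|_] := eqVneq (j, k) p; have [<-|_] := eqVneq (k, j) p.
    by rewrite gap_sym.
  by rewrite addr0 mul0r !mulr0.
have gapZ p : schur gap (schur (phi p) X) = gap p.1 p.2 *: schur (phi p) X.
  by apply: coords_inj => j k; rewrite coordsZ !coords_schur [LHS]mulrA gap_phi -mulrA.
exists (fun p => schur (phi p) X); split.
- by rewrite -schur_suml -[LHS]schur1; apply: eq_schur => j k; rewrite phi1.
- under eq_bigr do rewrite -gapZ schurM.
  rewrite -schur_suml; apply: eq_schur => j k.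
  by rewrite -mulr_sumr phi1 mulr1.
- move=> p; split; first exact: skew_schur.
  rewrite ad_sqr gapZ -[X in schur _ X]addr0 schur_linear gapZ scalerA.
  rewrite (_ : schur gap 0 = 0) ?addr0//.
  by apply: coords_inj => j k; rewrite coords_schur coords0 mulr0.
Qed.

End SchurMultipliers.

(** * The normal and Kaehler metrics *)

Section NormalAndKahler.
Variables (R : realType) (n : nat).
Local Open Scope sesquilinear_scope.
Local Notation M := 'M[R[i]]_n.
Implicit Types (X Y Z L : M).

Lemma skewhermP X : skewherm X <-> forall j k, (X k j)^* = - X j k.
Proof.
split=> [XJ j k|XJ]; first by have /matrixP/(_ j k) := XJ; rewrite !mxE.
by apply/matrixP => j k; rewrite !mxE XJ.
Qed.

Lemma skewhermD X Y : skewherm X -> skewherm Y -> skewherm (X + Y).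
Proof.
move=> /skewhermP sX /skewhermP sY; apply/skewhermP => j k.
by rewrite !mxE rmorphD/= sX sY opprD.
Qed.

Lemma skewhermN X : skewherm X -> skewherm (- X).
Proof.
move=> /skewhermP sX; apply/skewhermP => j k.
by rewrite !mxE rmorphN/= sX.
Qed.

Lemma skewhermB X Y : skewherm X -> skewherm Y -> skewherm (X - Y).
Proof. by move=> sX sY; exact: skewhermD sX (skewhermN sY). Qed.

Lemma conjC_realC (a : R) : (a%:C)^* = a%:C :> R[i].
Proof. by apply/CrealP; rewrite complex_real. Qed.

Lemma skewhermZ (a : R) X : skewherm X -> skewherm (a%:C *: X).
Proof.
move=> /skewhermP sX; apply/skewhermP => j k.
by rewrite !mxE rmorphM/= sX conjC_realC mulrN.
Qed.

Lemma skewherm0 : skewherm (0 : M).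
Proof. by apply/skewhermP => j k; rewrite !mxE conjC0 oppr0. Qed.


Lemma skewherm_commx X Y : skewherm X -> skewherm Y -> skewherm (commx X Y).
Proof.
rewrite /skewherm /commx /= => sX sY.
rewrite linearB/= map_mxB !trmxC_mul sX sY.
by rewrite !mulNmx !mulmxN !opprK opprB.
Qed.

Lemma commxBr L X Y : commx L (X - Y) = commx L X - commx L Y.
Proof.
rewrite /commx mulmxBr mulmxBl !opprB addrACA [RHS]addrACA; congr (_ + _).
exact: addrC.
Qed.

Lemma mxtrace_commx X Y : \tr (commx X Y) = 0.
Proof. by rewrite /commx raddfB/= mxtrace_mulC subrr. Qed.

Lemma nu_traceless X Y : \tr X = 0 -> nu X Y = complex.Re (2 * n%:R * \tr (X *m Y)).
Proof. by move=> trX; rewrite /nu trX mulr0 mul0r subr0. Qed.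

Lemma Re_ge0 (z : R[i]) : 0 <= z -> 0 <= complex.Re z.
Proof. by rewrite lecE => /andP[]. Qed.

Lemma u_dotxx X : skewherm X ->
  u_dot X X = complex.Re (\sum_j \sum_k X j k * (X j k)^*).
Proof.
move=> /skewhermP sX; rewrite /u_dot -[LHS]raddfN; congr complex.Re.
rewrite /mxtrace -sumrN; apply: eq_bigr => j _; rewrite mxE -sumrN.
by apply: eq_bigr => k _; rewrite sX mulrN.
Qed.

Lemma u_dotxx_le0 X : skewherm X -> u_dot X X <= 0 -> X = 0.
Proof.
move=> sX; rewrite u_dotxx//; set q := \sum_j _ => q0.
have tpos j k : 0 <= X j k * (X j k)^* by rewrite mul_conjC_ge0.
have rpos j : 0 <= \sum_k X j k * (X j k)^* by rewrite sumr_ge0.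
have qpos : 0 <= q by apply: sumr_ge0.
have : q == 0.
  rewrite eq_le qpos andbT; move: qpos q0; rewrite !lecE => /andP[/eqP /= q1 _] ->.
  by rewrite q1 eqxx.
rewrite psumr_eq0// => /allP q00; apply/matrixP => j k.
have := q00 j; rewrite mem_index_enum psumr_eq0// => /(_ isT)/allP/(_ k).
by rewrite mem_index_enum mul_conjC_eq0 mxE => /(_ isT)/eqP.
Qed.

Section PositiveSquareRoot.
Variables T S : M -> M.
Hypothesis TS : is_pos_sqrt T S.

(** The matrix Z = S X - a X satisfies S Z = - a Z, which positivity of [S] forbids for a > 0 unless
    Z = 0. *)
Lemma pos_sqrt_eigenvector (a : R) X : 0 <= a -> skewherm X ->
  T X = (a ^+ 2)%:C *: X -> S X = a%:C *: X.
Proof.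
move=> a0 sX TX; have [Sskew Slin Ssym Spos SS] := TS.
pose Z := (- a)%:C *: X + S X.
have sSX := Sskew _ sX; have sZ : skewherm Z by exact: skewhermD (skewhermZ _ sX) sSX.
have SZ : S Z = (- a)%:C *: Z.
  rewrite Slin// SS// TX scalerDr scalerA addrC; congr (_ *: _ + _).
  by rewrite -rmorphM/= mulrNN.
have ZE : u_dot (S Z) Z = - a * u_dot Z Z.
  rewrite /u_dot SZ -scalemxAl mxtraceZ mulrN.
  rewrite -[X in _ = - X](_ : complex.Re ((- a)%:C * \tr (Z *m Z)) = _)//.
  by case: (\tr (Z *m Z)) => x y /=; rewrite mul0r subr0.
suff Z0 : Z = 0.
  by move: Z0 => /eqP; rewrite /Z addrC addr_eq0 rmorphN/= scaleNr opprK => /eqP.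
apply: u_dotxx_le0 => //.
(* For [a = 0] positivity gives nothing; instead, symmetry equates the squared norm of [Z = S X]
   with the product of [X] and [S Z = 0]. *)
have := Spos _ sZ; rewrite ZE; move: a0; rewrite le_eqVlt => /predU1P[a0 _|a0].
  have Z_SX : Z = S X by rewrite /Z -a0 oppr0 scale0r add0r.
  rewrite [X in u_dot X _]Z_SX Ssym// SZ -a0 oppr0 scale0r.
  by rewrite /u_dot mulmx0 mxtrace0 oppr0.
by rewrite mulNr oppr_ge0 pmulr_rle0.
Qed.

Lemma pos_sqrt_sum (I : finType) (Z : I -> M) : (forall i, skewherm (Z i)) ->
  S (\sum_i Z i) = \sum_i S (Z i).
Proof.
move=> sZ; have [Sskew Slin _ _ _] := TS.
have S0 : S 0 = 0.
  have := Slin 1 _ _ skewherm0 skewherm0; rewrite scale1r addr0 scale1r => /eqP.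
  by rewrite -subr_eq0 opprD addNKr oppr_eq0 => /eqP.
(* Additivity of [S] holds only on skew-Hermitian matrices, so the induction carries skewness
   along. *)
pose P (X Y : M) := skewherm X /\ S X = Y.
suff [] : P (\sum_i Z i) (\sum_i S (Z i)) by [].
apply: (big_ind2 P) => [|X1 X2 Y1 Y2 [sX <-] [sY <-]|i _]; rewrite /P.
- by split; first exact: skewherm0.
- split; first exact: skewhermD.
  by have := Slin 1 _ _ sX sY; rewrite !scale1r.
- by [].
Qed.

End PositiveSquareRoot.

Variables (lambda : 'rV[R]_n) (h : M).
Hypothesis lambda_decr : forall i j : 'I_n, (i < j)%N -> lambda 0 j < lambda 0 i.
Hypothesis uh : h \is unitarymx.
Let L := orbit_point lambda h.
Let l (j : 'I_n) : R[i] := (lambda 0 j)%:C.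
Let LE : L = h *m diag_mx (\row_j ('i * l j)) *m h ^t*.
Proof. by rewrite /L /orbit_point (invmx_unitary uh). Qed.
Let l_inj : injective l.
Proof. by move=> j k /complexI/eqP; rewrite (lambda_eq lambda_decr) => /eqP. Qed.
Let l_real j : l j \is Num.real.
Proof. by rewrite complex_real. Qed.
Local Notation sch phi := (schur h phi).
Local Notation gap := (gap l).

Lemma skewherm_orbit_point : skewherm L.
Proof. rewrite LE; exact: (skew_orbit uh). Qed.

Lemma im_ad_schur phi X :
  (forall j k, (phi k j)^* = phi j k) -> (forall j, phi j j = 0) ->
  skewherm X -> im_ad L (sch phi X).
Proof. rewrite LE; exact: (schur_in_im_ad uh). Qed.

Lemma im_ker_ad0 X : im_ad L X -> ker_ad L X -> X = 0.
Proof. rewrite LE => -[Y _ ->] [_]; exact: (ad_sqr_eq0 uh). Qed.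

Lemma skewherm_offdiag X : skewherm X -> skewherm (sch (@offdiag _ _) X).
Proof. exact: (skew_schur uh (@conj_offdiag _ _)). Qed.

Lemma im_ad_sub X Y : im_ad L X -> im_ad L Y -> im_ad L (X - Y).
Proof.
by move=> [X' sX ->] [Y' sY ->]; exists (X' - Y'); [exact: skewhermB|rewrite commxBr].
Qed.

Lemma ker_ad_sub X Y : ker_ad L X -> ker_ad L Y -> ker_ad L (X - Y).
Proof.
by move=> [sX X0] [sY Y0]; split; [exact: skewhermB|rewrite commxBr X0 Y0 subr0].
Qed.

(** The off-diagonal part is one valid choice; two choices differ by an element of both the image
    and the kernel of ad_L. *)
Lemma im_partE X : skewherm X -> im_part L X = sch (@offdiag _ _) X.
Proof.
move=> sX; have sO := skewherm_offdiag sX.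
have iO : im_ad L (sch (@offdiag _ _) X).
  by apply: im_ad_schur sX => [j k|j]; [exact: conj_offdiag|rewrite /offdiag eqxx].
have kO : ker_ad L (X - sch (@offdiag _ _) X).
  split; first exact: skewhermB.
  rewrite LE; exact: (ad_diag_part uh).
apply: xget_unique => [|P [iP kP]]; first by split.
apply/eqP; rewrite -subr_eq0; apply/eqP; apply: im_ker_ad0.
  exact: im_ad_sub iP iO.
have -> : P - sch (@offdiag _ _) X = (X - sch (@offdiag _ _) X) - (X - P).
  by rewrite opprB [RHS]addrC addrA subrK.
exact: ker_ad_sub kO kP.
Qed.

Lemma ad_inj_offdiag X Y :
  commx L X = commx L Y -> sch (@offdiag _ _) X = sch (@offdiag _ _) Y.
Proof. rewrite LE; exact: (schur_offdiag_ad uh l_inj). Qed.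

(** Other representatives of the same tangent vectors have the same off-diagonal parts, so the
    [xget] has a single candidate value. *)
Lemma normal_metricE X Y : skewherm X -> skewherm Y ->
  normal_metric L (commx L X) (commx L Y) =
  - nu (sch (@offdiag _ _) X) (sch (@offdiag _ _) Y).
Proof.
move=> sX sY; apply: xget_unique => [|_ [X' [Y' [[sX' sY'] eX eY ->]]]].
  exists X, Y; split; [by split|exact: erefl|exact: erefl|].
  exact: (congr2 (fun A B => - nu A B) (esym (im_partE sX)) (esym (im_partE sY))).
exact: (congr2 (fun A B => - nu A B)
  (etrans (im_partE sX') (esym (ad_inj_offdiag eX)))
  (etrans (im_partE sY') (esym (ad_inj_offdiag eY)))).
Qed.

Let T X := - commx L (commx L X).

Let TE X : T X = sch gap (sch gap X).
Proof. rewrite /T LE; exact: (ad_sqr uh). Qed.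

Lemma is_pos_sqrt_gap : is_pos_sqrt T (sch gap).
Proof.
split=> [X|a X Y _ _|X Y _ _|X sX|X _].
- exact: (skew_schur uh (conj_gap l)).
- exact: (schur_linear uh).
- by rewrite /u_dot mxtrace_schur_gapC.
- rewrite /u_dot -[leRHS]raddfN; apply: Re_ge0.
  by apply: (mxtrace_schur_ge0 uh) => // j k; exact: normr_ge0.
- exact/esym/TE.
Qed.

(** [pos_sqrt T] is only known to be some positive root. Splitting [X] into eigenvectors of [T]
    determines its value, since any positive root scales an eigenvector by the nonnegative root of
    the eigenvalue. *)
Lemma pos_sqrtE X : skewherm X -> pos_sqrt T X = sch gap X.
Proof.
move=> sX; have [Z [XE gapXE ZP]] := schur_gap_eigen uh l_real sX.
have TS : is_pos_sqrt T (pos_sqrt T).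
  exact: (@xgetPex _ _ (is_pos_sqrt T) (ex_intro _ _ is_pos_sqrt_gap)).
rewrite gapXE [in LHS]XE (pos_sqrt_sum TS) => [|p]; last exact: (ZP p).1.
apply: eq_bigr => p _; have [sZ TZ] := ZP p.
have gapE : gap p.1 p.2 = (complex.Re (gap p.1 p.2))%:C.
  by rewrite RRe_real// normr_real.
rewrite gapE; apply: (pos_sqrt_eigenvector TS) => //.
  by apply: Re_ge0; exact: normr_ge0.
by rewrite rmorphXn/= -gapE -TZ /T LE.
Qed.

(** This is minus the positive root of -ad_L^2, applied to [N]. *)
Definition kahler_grad (N : M) : M := sch (fun j k => - gap j k) N.

Lemma conj_gapN j k : (- gap k j)^* = - gap j k.
Proof. by rewrite rmorphN/= conj_gap. Qed.

Lemma im_ad_kahler_grad (N : M) : skewherm N -> im_ad L (kahler_grad N).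
Proof.
apply: im_ad_schur => [j k|j]; first exact: conj_gapN.
by rewrite gapxx oppr0.
Qed.

(** The root turns the gradient into [L, [L, N]], so the metric pairs the off-diagonal parts of
    [L, N] and [X]; invariance of the trace form then moves the commutator to [X]. *)
Lemma kahler_metric_grad (N : M) X : skewherm N -> skewherm X ->
  kahler_metric L (kahler_grad N) (commx L X) = nu (commx L X) N.
Proof.
move=> sN sX; have sLN := skewherm_commx skewherm_orbit_point sN.
have sG : skewherm (kahler_grad N) by exact: (skew_schur uh conj_gapN).
rewrite /kahler_metric -/T (pos_sqrtE sG).
have -> : sch gap (kahler_grad N) = commx L (commx L N).
  rewrite LE; exact: (schur_gap_grad uh l_real).
(* Off-diagonal parts and commutators are traceless, so [nu] reduces to a multiple of the trace
   form. *)
rewrite (normal_metricE sLN sX) (nu_traceless _ (mxtrace_offdiag uh _)).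
rewrite (nu_traceless _ (mxtrace_commx L X)) -[LHS]raddfN; congr complex.Re.
rewrite -mulrN; congr (_ * _); apply: oppr_inj; rewrite opprK LE.
exact: (mxtrace_offdiag_ad uh).
Qed.

End NormalAndKahler.

(** * Complex-valued linear differential equations *)

Section ComplexDerivative.
Variable R : realType.
Implicit Types (f g : R -> R[i]) (t : R) (D E z : R[i]).

(** By definition, [is_mx_derive] is this condition on every entry. *)
Definition is_cderive f t D : Prop :=
  is_derive t (1 : R) (fun s => complex.Re (f s)) (complex.Re D) /\
  is_derive t (1 : R) (fun s => complex.Im (f s)) (complex.Im D).

Lemma is_cderive_eq f t D E : is_cderive f t D -> D = E -> is_cderive f t E.
Proof. by move=> ? <-. Qed.

Lemma is_cderive_cst z t : is_cderive (fun=> z) t 0.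
Proof. by split; exact: is_derive_cst. Qed.

Lemma is_cderiveD f g t D E : is_cderive f t D -> is_cderive g t E ->
  is_cderive (fun s => f s + g s) t (D + E).
Proof.
move=> [f1 f2] [g1 g2]; split; rewrite raddfD.
  have -> : (fun s => complex.Re (f s + g s)) =
      (fun s => complex.Re (f s)) + (fun s => complex.Re (g s)).
    by apply/funext => s; rewrite raddfD.
  exact: is_deriveD.
have -> : (fun s => complex.Im (f s + g s)) =
    (fun s => complex.Im (f s)) + (fun s => complex.Im (g s)).
  by apply/funext => s; rewrite raddfD.
exact: is_deriveD.
Qed.

Lemma is_cderiveN f t D : is_cderive f t D -> is_cderive (fun s => - f s) t (- D).
Proof.
move=> [f1 f2]; split; rewrite raddfN.
  have -> : (fun s => complex.Re (- f s)) = - (fun s => complex.Re (f s)).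
    by apply/funext => s; rewrite raddfN.
  exact: is_deriveN.
have -> : (fun s => complex.Im (- f s)) = - (fun s => complex.Im (f s)).
  by apply/funext => s; rewrite raddfN.
exact: is_deriveN.
Qed.

Lemma is_cderiveB f g t D E : is_cderive f t D -> is_cderive g t E ->
  is_cderive (fun s => f s - g s) t (D - E).
Proof. by move=> fD gE; apply: is_cderiveD fD _; exact: is_cderiveN. Qed.

Lemma ReD (x y : R[i]) : complex.Re (x + y) = complex.Re x + complex.Re y.
Proof. by case: x y => [a b] [c d]. Qed.

Lemma ImD (x y : R[i]) : complex.Im (x + y) = complex.Im x + complex.Im y.
Proof. by case: x y => [a b] [c d]. Qed.

Lemma ReM (x y : R[i]) :
  complex.Re (x * y) = complex.Re x * complex.Re y - complex.Im x * complex.Im y.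
Proof. by case: x y => [a b] [c d]. Qed.

Lemma ImM (x y : R[i]) :
  complex.Im (x * y) = complex.Re x * complex.Im y + complex.Im x * complex.Re y.
Proof. by case: x y => [a b] [c d]. Qed.

Lemma is_cderiveM f g t D E : is_cderive f t D -> is_cderive g t E ->
  is_cderive (fun s => f s * g s) t (D * g t + f t * E).
Proof.
move=> [f1 f2] [g1 g2]; split.
  have -> : (fun s => complex.Re (f s * g s)) =
      (fun s => complex.Re (f s)) * (fun s => complex.Re (g s)) -
      (fun s => complex.Im (f s)) * (fun s => complex.Im (g s)).
    by apply/funext => s; rewrite ReM.
  apply: is_derive_eq (is_deriveD (is_deriveM f1 g1) (is_deriveN (is_deriveM f2 g2))) _.
  by rewrite ReD !ReM /GRing.scale/=; ring.
have -> : (fun s => complex.Im (f s * g s)) =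
    (fun s => complex.Re (f s)) * (fun s => complex.Im (g s)) +
    (fun s => complex.Im (f s)) * (fun s => complex.Re (g s)).
  by apply/funext => s; rewrite ImM.
apply: is_derive_eq (is_deriveD (is_deriveM f1 g2) (is_deriveM f2 g1)) _.
by rewrite ImD !ImM /GRing.scale/=; ring.
Qed.

Lemma is_cderive_conj f t D : is_cderive f t D -> is_cderive (fun s => (f s)^*) t D^*.
Proof.
have ReJ (z : R[i]) : complex.Re z^* = complex.Re z by case: z.
have ImJ (z : R[i]) : complex.Im z^* = - complex.Im z by case: z.
move=> [f1 f2]; split; [rewrite ReJ|rewrite ImJ].
  by under eq_fun do rewrite ReJ.
have -> : (fun s => complex.Im (f s)^*) = - (fun s => complex.Im (f s)).
  by apply/funext => s; rewrite ImJ.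
exact: is_deriveN.
Qed.

Lemma is_cderive_real (f : R -> R) t (d : R) :
  is_derive t (1 : R) f d -> is_cderive (fun s => (f s)%:C) t d%:C.
Proof. by move=> fd; split=> //; exact: is_derive_cst. Qed.

Lemma is_cderive_sum (I : Type) (r : seq I) (F : I -> R -> R[i]) t (D : I -> R[i]) :
  (forall i, is_cderive (F i) t (D i)) ->
  is_cderive (fun s => \sum_(i <- r) F i s) t (\sum_(i <- r) D i).
Proof.
move=> FD; elim: r => [|i r IHr].
  by under eq_fun do rewrite big_nil; rewrite big_nil; exact: is_cderive_cst.
under eq_fun do rewrite big_cons; rewrite big_cons.
exact: is_cderiveD.
Qed.

Lemma is_cderive_expR (c : R) t :
  is_cderive (fun s => (expR (c * s))%:C) t (c%:C * (expR (c * t))%:C).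
Proof.
rewrite -rmorphM; apply: is_cderive_real.
have cid : is_derive t (1 : R) ( *%R c) c.
  have -> : ( *%R c) = c \*: id by [].
  by apply: is_derive_eq (is_deriveZ c (is_derive_id t 1)) _; rewrite /GRing.scale/= mulr1.
by apply: is_derive_eq (is_derive1_comp (is_derive_expR _) cid) _; rewrite mulrC.
Qed.

Definition ccontinuous f t : Prop :=
  {for t, continuous (fun s => complex.Re (f s))} /\
  {for t, continuous (fun s => complex.Im (f s))}.

Lemma is_derive_continuous (f : R -> R) t d :
  is_derive t (1 : R) f d -> {for t, continuous f}.
Proof. by move=> [fd _]; exact/differentiable_continuous/derivable1_diffP. Qed.

Lemma is_cderive_continuous f t D : is_cderive f t D -> ccontinuous f t.
Proof. by move=> [f1 f2]; split; exact: is_derive_continuous. Qed.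

Lemma ccontinuousD f g t : ccontinuous f t -> ccontinuous g t ->
  ccontinuous (fun s => f s + g s) t.
Proof.
move=> [f1 f2] [g1 g2]; split.
  have -> : (fun s => complex.Re (f s + g s)) =
      (fun s => complex.Re (f s)) + (fun s => complex.Re (g s)).
    by apply/funext => s; rewrite raddfD.
  exact: cvgD f1 g1.
have -> : (fun s => complex.Im (f s + g s)) =
    (fun s => complex.Im (f s)) + (fun s => complex.Im (g s)).
  by apply/funext => s; rewrite raddfD.
exact: cvgD f2 g2.
Qed.

Lemma ccontinuousM f g t : ccontinuous f t -> ccontinuous g t ->
  ccontinuous (fun s => f s * g s) t.
Proof.
move=> [f1 f2] [g1 g2]; split.
  have -> : (fun s => complex.Re (f s * g s)) =
      (fun s => complex.Re (f s)) * (fun s => complex.Re (g s)) -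
      (fun s => complex.Im (f s)) * (fun s => complex.Im (g s)).
    by apply/funext => s; rewrite ReM.
  exact: cvgB (cvgM f1 g1) (cvgM f2 g2).
have -> : (fun s => complex.Im (f s * g s)) =
    (fun s => complex.Re (f s)) * (fun s => complex.Im (g s)) +
    (fun s => complex.Im (f s)) * (fun s => complex.Re (g s)).
  by apply/funext => s; rewrite ImM.
exact: cvgD (cvgM f1 g2) (cvgM f2 g1).
Qed.

Lemma ccontinuous_cst z t : ccontinuous (fun=> z) t.
Proof. by split; exact: cvg_cst. Qed.

Lemma ccontinuous_sum (I : Type) (r : seq I) (P : pred I) (F : I -> R -> R[i]) t :
  (forall i, P i -> ccontinuous (F i) t) ->
  ccontinuous (fun s => \sum_(i <- r | P i) F i s) t.
Proof.
move=> FD; elim: r => [|i r IHr].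
  by under eq_fun do rewrite big_nil; exact: ccontinuous_cst.
case Pi : (P i); last by under eq_fun do rewrite big_cons Pi.
by under eq_fun do rewrite big_cons Pi; apply: ccontinuousD => //; exact: FD.
Qed.

End ComplexDerivative.

(** * Differentiation rules for matrix curves *)

Section MatrixDerivative.
Variables (R : realType) (n : nat).
Local Open Scope sesquilinear_scope.
Local Notation M := 'M[R[i]]_n.
Implicit Types (f g : R -> M) (t : R) (D E : M).

Lemma is_mx_derive_cst (A : M) t : is_mx_derive (fun=> A) t 0.
Proof. by move=> i j; rewrite mxE; exact: is_cderive_cst. Qed.

Lemma is_mx_deriveM f g t D E : is_mx_derive f t D -> is_mx_derive g t E ->
  is_mx_derive (fun s => f s *m g s) t (D *m g t + f t *m E).
Proof.
move=> fD gE i j.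
suff : is_cderive (fun s => (f s *m g s) i j) t ((D *m g t + f t *m E) i j) by [].
under eq_fun do rewrite mxE; rewrite !mxE -big_split/=.
by apply: is_cderive_sum => k; apply: is_cderiveM; [exact: fD|exact: gE].
Qed.

Lemma is_mx_deriveMl (A : M) f t D : is_mx_derive f t D ->
  is_mx_derive (fun s => A *m f s) t (A *m D).
Proof.
move=> fD; have := is_mx_deriveM (is_mx_derive_cst A t) fD.
by rewrite mul0mx add0r.
Qed.

Lemma is_mx_deriveMr (A : M) f t D : is_mx_derive f t D ->
  is_mx_derive (fun s => f s *m A) t (D *m A).
Proof.
move=> fD; have := is_mx_deriveM fD (is_mx_derive_cst A t).
by rewrite mulmx0 addr0.
Qed.

Lemma is_mx_deriveB f g t D E : is_mx_derive f t D -> is_mx_derive g t E ->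
  is_mx_derive (fun s => f s - g s) t (D - E).
Proof.
move=> fD gE i j.
suff : is_cderive (fun s => (f s - g s) i j) t ((D - E) i j) by [].
under eq_fun do rewrite 2!mxE; rewrite 2!mxE.
by apply: is_cderiveB; [exact: fD|exact: gE].
Qed.

Lemma is_mx_deriveZ (z : R[i]) f t D : is_mx_derive f t D ->
  is_mx_derive (fun s => z *: f s) t (z *: D).
Proof.
move=> fD i j.
suff : is_cderive (fun s => (z *: f s) i j) t ((z *: D) i j) by [].
under eq_fun do rewrite mxE; rewrite mxE.
have := is_cderiveM (is_cderive_cst z t) (fD i j).
by rewrite mul0r add0r.
Qed.

Lemma is_mx_derive_trmxC f t D : is_mx_derive f t D ->
  is_mx_derive (fun s => (f s) ^t*) t (D ^t*).
Proof.
move=> fD i j.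
suff : is_cderive (fun s => ((f s) ^t*) i j) t ((D ^t*) i j) by [].
under eq_fun do rewrite 2!mxE; rewrite 2!mxE.
exact: is_cderive_conj (fD j i).
Qed.

End MatrixDerivative.

(** * Scalar linear equations on an open interval *)

Section LinearODE.
Variables (R : realType) (J : set R).
Hypotheses (J_open : open J) (J_interval : is_interval J) (J0 : J 0).

(** Supplies a segment in [J] around both the base point 0 and [t], on which the fundamental theorem
    of calculus can be applied. *)
Lemma interval_margin t : J t ->
  exists a b, [/\ J a, J b, a < 0 < b & a < t < b].
Proof.
move=> Jt.
have left_right s : J s -> exists a b, [/\ J a, J b & a < s < b].
  move=> Js; have /nbhs_ballP[e /= e0 sub] := open_nbhs_nbhs (conj J_open Js).
  exists (s - e / 2), (s + e / 2); split; try (apply: sub; rewrite /ball/=).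
  - by rewrite opprB addrC subrK gtr0_norm ?divr_gt0// ltr_pdivrMr//; lra.
  - by rewrite opprD addrA subrr sub0r normrN gtr0_norm ?divr_gt0// ltr_pdivrMr//; lra.
  - by rewrite ltrBlDr ltrDl divr_gt0.
have [a [b [Ja Jb /andP[at_ tb]]]] := left_right _ Jt.
have [a' [b' [Ja' Jb' /andP[a0 b0]]]] := left_right _ J0.
exists (Num.min a a'), (Num.max b b'); split.
- by rewrite /Num.min; case: ifP.
- by rewrite /Num.max; case: ifP.
- by rewrite gt_min lt_max a0 b0 !orbT.
- by rewrite gt_min lt_max at_ tb.
Qed.

Lemma exists_primitive (h : R -> R) : (forall t, J t -> {for t, continuous h}) ->
  exists2 H : R -> R, H 0 = 0 & forall t, J t -> is_derive t (1 : R) H (h t).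
Proof.
move=> hc; pose mu := @lebesgue_measure R.
pose I (a b : R) := \int[mu]_(s in `[a, b]) h s.
(* The signed integral from 0 to [x]. *)
exists (fun x => if 0 <= x then I 0 x else - I x 0).
  by rewrite lexx /I set_itv1 Rintegral_set1.
move=> t Jt; have [a [b [Ja Jb /andP[a0 b0] /andP[at_ tb]]]] := interval_margin Jt.
have inth x y : a <= x -> y <= b -> mu.-integrable `[x, y] (EFin \o h).
  move=> ax yb; apply: continuous_compact_integrable; first exact: segment_compact.
  apply: continuous_in_subspaceT => s; rewrite inE/= in_itv/= => /andP[xs sy].
  by apply: hc; apply: (J_interval Ja Jb); rewrite (le_trans ax xs) (le_trans sy yb).
have split_int x y : a <= x -> x <= y -> y <= b -> I a y - I a x = I x y.
  move=> ax xy yb; rewrite /I Rintegral_itvB.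
  - rewrite Rintegral_itv_obnd_cbnd//.
    apply: (integrableS _ _ _ (inth x y ax yb)) => //.
    by move=> z /=; rewrite !in_itv/= => /andP[/ltW -> ->].
  - exact: inth.
  - by rewrite bnd_simp.
  - by rewrite bnd_simp.
have [Fd Ft] := continuous_FTC1_closed tb (inth a b (lexx a) (lexx b)) at_ (hc t Jt).
have FD : is_derive t (1 : R) (I a) (h t).
  by apply: DeriveDef; [exact: Fd|rewrite -derive1E].
(* On either side of 0, the function agrees near [t] with the integral from [a] minus a constant. *)
apply: (@near_eq_is_derive _ _ _ (fun x => I a x - I a 0)).
  have : \forall x \near t, x \in `]a, b[.
    by apply: near_in_itvoo; rewrite in_itv/= at_ tb.
  apply: filterS => x; rewrite in_itv/= => /andP[ax xb].
  case: ifPn => [x0|]; first by rewrite split_int// ltW.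
  rewrite -ltNge => x0; rewrite -(split_int x 0) ?opprB// ltW//.
apply: is_derive_eq (is_deriveD FD (is_derive_cst (- I a 0) t 1)) _.
by rewrite addr0.
Qed.

Lemma exists_cprimitive (h : R -> R[i]) : (forall t, J t -> ccontinuous h t) ->
  exists2 H : R -> R[i], H 0 = 0 & forall t, J t -> is_cderive H t (h t).
Proof.
move=> hc.
have [H1 H10 dH1] := exists_primitive (fun t Jt => (hc t Jt).1).
have [H2 H20 dH2] := exists_primitive (fun t Jt => (hc t Jt).2).
exists (fun s => Complex (H1 s) (H2 s)); first by rewrite H10 H20.
by move=> t Jt; split; [exact: dH1|exact: dH2].
Qed.

Lemma is_derive0_cst (f : R -> R) : (forall t, J t -> is_derive t (1 : R) f 0) ->
  forall t, J t -> f t = f 0.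
Proof.
move=> fD.
have cst a b : J a -> J b -> a <= b -> f b = f a.
  move=> Ja Jb ab.
  have Jab x : a <= x <= b -> J x by exact: J_interval Ja Jb x.
  have [||c _ /eqP] := @MVT_segment _ f (cst 0) a b ab.
  - by move=> x; rewrite in_itv/= => /andP[ax xb]; apply/fD/Jab; rewrite !ltW.
  - apply: derivable_within_continuous => x; rewrite in_itv/= => /Jab Jx.
    by have [] := fD x Jx.
  - by rewrite mul0r subr_eq0 => /eqP.
move=> t Jt; have [t0|/ltW t0] := leP 0 t; first exact: cst.
exact/esym/cst.
Qed.

Lemma is_cderive0_cst (f : R -> R[i]) : (forall t, J t -> is_cderive f t 0) ->
  forall t, J t -> f t = f 0.
Proof.
move=> fD t Jt; apply/eqP; rewrite eq_complex; apply/andP; split; apply/eqP.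
  exact: (@is_derive0_cst (fun s => complex.Re (f s)) (fun s Js => (fD s Js).1)).
exact: (@is_derive0_cst (fun s => complex.Im (f s)) (fun s Js => (fD s Js).2)).
Qed.

Lemma is_cderive_exp_primitive (C : R -> R) (t c : R) : is_derive t (1 : R) C c ->
  is_cderive (fun s => (expR (C s))%:C) t (c%:C * (expR (C t))%:C).
Proof.
move=> dC; rewrite -rmorphM; apply: is_cderive_real.
by apply: is_derive_eq (is_derive1_comp (is_derive_expR _) dC) _; rewrite mulrC.
Qed.

(** Integrating factor: [f] times exp(-C) has derivative zero. *)
Lemma linear_ode_unique (c C : R -> R) (f : R -> R[i]) : C 0 = 0 ->
  (forall t, J t -> is_derive t (1 : R) C (c t)) ->
  (forall t, J t -> is_cderive f t ((c t)%:C * f t)) ->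
  forall t, J t -> f t = f 0 * (expR (C t))%:C.
Proof.
move=> C0 dC df t Jt.
pose g s := f s * (expR (- C s))%:C.
have dg s : J s -> is_cderive g s 0.
  move=> Js; have dNC : is_derive s (1 : R) (fun x => - C x) (- c s).
    exact: is_deriveN (dC s Js).
  have := is_cderiveM (df s Js) (is_cderive_exp_primitive dNC).
  by move=> /is_cderive_eq; apply; rewrite rmorphN/=; ring.
have := is_cderive0_cst dg Jt; rewrite /g C0 oppr0 expR0 mulr1 => <-.
by rewrite -mulrA -rmorphM/= -expRD addNr expR0 mulr1.
Qed.

(** Variation of constants, with [K] a primitive of [h] times exp(-C). *)
Lemma linear_ode_exists (c : R -> R) (h : R -> R[i]) (z : R[i]) :
  (forall t, J t -> {for t, continuous c}) -> (forall t, J t -> ccontinuous h t) ->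
  exists2 f : R -> R[i], f 0 = z &
    forall t, J t -> is_cderive f t ((c t)%:C * f t + h t).
Proof.
move=> cc hc; have [C C0 dC] := exists_primitive cc.
have [|K K0 dK] := @exists_cprimitive (fun s => h s * (expR (- C s))%:C).
  move=> t Jt; apply: ccontinuousM; first exact: hc.
  have dNC : is_derive t (1 : R) (fun x => - C x) (- c t) by exact: is_deriveN (dC t Jt).
  exact: is_cderive_continuous (is_cderive_exp_primitive dNC).
exists (fun s => (expR (C s))%:C * (z + K s)).
  by rewrite C0 expR0 K0 addr0 mul1r.
move=> t Jt.
have := is_cderiveM (is_cderive_exp_primitive (dC t Jt))
  (is_cderiveD (is_cderive_cst z t) (dK t Jt)).
move=> /is_cderive_eq; apply; rewrite add0r mulrA; congr (_ + _).
  by rewrite mulrA.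
by rewrite mulrAC -rmorphM/= -expRD subrr expR0 mul1r.
Qed.

End LinearODE.

(** * Upper triangular linear systems *)

Section UpperTriangularODE.
Variables (R : realType) (n : nat) (J : set R).
Hypotheses (J_open : open J) (J_interval : is_interval J) (J0 : J 0).
Local Notation M := 'M[R[i]]_n.
Variable U : R -> M.
Hypothesis U_upper : forall t, J t -> is_upper_mx (U t).
Hypothesis U_real : forall t, J t -> forall i, U t i i = (complex.Re (U t i i))%:C.
Hypothesis U_cont : forall t, J t -> forall i j, ccontinuous (fun s => U s i j) t.

Lemma mul_upper_entry (V X : M) i j : is_upper_mx V ->
  (V *m X) i j = V i i * X i j + \sum_(k < n | (i < k)%N) V i k * X k j.
Proof.
move=> /is_upper_mxP uV; rewrite mxE (bigD1 i)//=; congr (_ + _).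
rewrite big_mkcond [RHS]big_mkcond; apply: eq_bigr => k _.
rewrite neq_ltn; have [ki|ik|/val_inj ->] := ltngtP k i.
- by rewrite uV// mul0r.
- by [].
- by [].
Qed.

(** Each entry of row [i] solves a scalar equation whose source involves only lower rows, so the
    rows are solved from the bottom up. Real diagonal entries of [U] give real integrating
    factors. *)
Lemma upper_ode_exists (Z : M) : exists2 r : R -> M, r 0 = Z &
  forall t, J t -> is_mx_derive r t (U t *m r t).
Proof.
(* Induction on the number [m] of solved rows, those with index at least [n - m]. *)
suff : forall m, (m <= n)%N -> exists2 r : R -> M, r 0 = Z &
    forall t, J t -> forall i j : 'I_n, (n - m <= i)%N ->
      is_cderive (fun s => r s i j) t ((U t *m r t) i j).
  move=> /(_ n (leqnn n))[r r0 dr]; exists r => // t Jt i j.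
  by apply: dr => //; rewrite subnn.
elim=> [|m IHm] mn.
  exists (fun=> Z) => // t _ i j; rewrite subn0 leqNgt => /negP[].
  exact: ltn_ord.
have [r r0 dr] := IHm (ltnW mn).
have i0n : (n - m.+1 < n)%N by lia.
pose i0 := Ordinal i0n.
have solve j : exists f : R -> R[i], f 0 = Z i0 j /\ forall t, J t ->
    is_cderive f t (U t i0 i0 * f t + \sum_(k < n | (i0 < k)%N) U t i0 k * r t k j).
  have [||f f0 df] := @linear_ode_exists R J J_open J_interval J0
      (fun s => complex.Re (U s i0 i0))
      (fun s => \sum_(k < n | (i0 < k)%N) U s i0 k * r s k j) (Z i0 j).
  - by move=> t Jt; exact: (U_cont Jt i0 i0).1.
  - move=> t Jt; apply: ccontinuous_sum => k ik; apply: ccontinuousM; first exact: U_cont.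
    apply: is_cderive_continuous; apply: dr => //.
    by move: ik => /=; lia.
  - by exists f; split=> // t Jt; rewrite U_real//; exact: df.
have [f fP] := choice solve.
exists (fun s => \matrix_(i, j) (if i == i0 then f j s else r s i j)).
  by apply/matrixP => i j; rewrite mxE; case: eqP => [->|_]; [exact: (fP j).1|rewrite r0].
move=> t Jt i j ni; rewrite (mul_upper_entry _ _ _ (U_upper Jt)).
under eq_fun do rewrite mxE; rewrite mxE.
have sumE : \sum_(k < n | (i < k)%N)
      U t i k * (\matrix_(i, j) (if i == i0 then f j t else r t i j)) k j =
    \sum_(k < n | (i < k)%N) U t i k * r t k j.
  apply: eq_bigr => k ik; rewrite mxE; case: eqP => // ki0.
  by move: ik ni; rewrite ki0 /= => ik ni; move: ik; rewrite ltnNge ni.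
rewrite sumE; case: eqP => [->|/eqP ii0]; first exact: (fP j).2.
rewrite -(mul_upper_entry _ _ _ (U_upper Jt)); apply: dr => //.
by move: ii0 ni; rewrite -val_eqE /=; lia.
Qed.

(** When the lower part of the column vanishes, the entry solves a homogeneous scalar equation. *)
Lemma upper_ode_entry (r : R -> M) (i j : 'I_n) :
  (forall t, J t -> is_mx_derive r t (U t *m r t)) ->
  (forall t (k : 'I_n), J t -> (i < k)%N -> r t k j = 0) ->
  exists C : R -> R, forall t, J t -> r t i j = r 0 i j * (expR (C t))%:C.
Proof.
move=> dr r0.
have [C C0 dC] := exists_primitive J_open J_interval J0 (fun t Jt => (U_cont Jt i i).1).
exists C => t Jt.
apply: (linear_ode_unique J_interval J0 (f := fun s => r s i j) C0 dC) => // s Js.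
have := dr s Js i j; rewrite (mul_upper_entry _ _ _ (U_upper Js)).
rewrite big1 ?addr0 => [|k ik]; last by rewrite r0// mulr0.
by rewrite -U_real.
Qed.

Lemma upper_ode_zero (r : R -> M) :
  (forall t, J t -> is_mx_derive r t (U t *m r t)) -> r 0 = 0 ->
  forall t, J t -> r t = 0.
Proof.
move=> dr r0 t Jt; apply/matrixP => i j; rewrite mxE.
have [m] := ubnP (n - i); elim: m => // m IHm in i t Jt * => im.
have [|C -> //] := @upper_ode_entry r i j dr; last by rewrite r0 mxE mul0r.
move=> s k Js ik; apply: IHm => //.
by have := ltn_ord k; lia.
Qed.

(** From the bottom row upwards, entries below the diagonal start at zero and stay there; each
    diagonal entry is then a positive multiple of its initial value one. *)
Lemma upper_ode_borel (r : R -> M) :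
  (forall t, J t -> is_mx_derive r t (U t *m r t)) -> r 0 = 1%:M ->
  forall t, J t -> borel (r t) /\ forall i, 0 < r t i i.
Proof.
move=> dr r0.
have low (i j : 'I_n) t : J t -> (j < i)%N -> r t i j = 0.
  have [m] := ubnP (n - i); elim: m => // m IHm in i t * => im Jt ji.
  have [|C -> //] := @upper_ode_entry r i j dr; last first.
    by rewrite r0 mxE -val_eqE (gtn_eqF ji) mul0r.
  move=> s k Js ik; apply: IHm => //; last exact: ltn_trans ik.
  by have := ltn_ord k; lia.
move=> t Jt.
have pos i : 0 < r t i i.
  have [s k Js|C ->//] := @upper_ode_entry r i i dr; first exact: low.
  by rewrite r0 mxE eqxx mul1r ltcR expR_gt0.
split=> //; apply/borelP; split; first by apply/is_upper_mxP => i j; exact: low.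
by move=> i; rewrite gt_eqF.
Qed.

End UpperTriangularODE.

(** * Algebra of the twisted velocity *)

Section TwistedVelocity.
Variables (C : numClosedFieldType) (n : nat).
Local Open Scope sesquilinear_scope.
Local Notation M := 'M[C]_n.

(** The left side is the derivative of A V - V D when A' = [U, A] and V' = U V. *)
Lemma lax_identity (U A V D : M) :
  (U *m A - A *m U) *m V + A *m (U *m V) - U *m V *m D = U *m (A *m V - V *m D).
Proof. by rewrite mulmxBl mulmxBr !mulmxA addrNK. Qed.

Variables (l : 'I_n -> C) (d : 'rV[C]_n) (u P : M).
Hypothesis l_decr : forall j k : 'I_n, (j < k)%N -> l k < l j.
Hypothesis d_sign : forall j, d 0 j * d 0 j = 1.
Hypothesis d_real : forall j, d 0 j \is Num.real.
Hypothesis uu : u \is unitarymx.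
Let A := u *m diag_mx (\row_j l j) *m u ^t*.
Hypothesis P_low : forall j k : 'I_n, (k < j)%N -> P j k = A j k.
Hypothesis P_up : forall j k : 'I_n, (j < k)%N -> P j k = - A j k.

Let D := diag_mx d.
(** When [D] is delta, this is iota of the unitary matrix [u]. *)
Let h := D *m u ^t* *m D.

Lemma sign_mxK : D *m D = 1%:M.
Proof.
apply/matrixP => j k; rewrite mul_diag_mx !mxE mulrnAr d_sign.
by rewrite eq_sym.
Qed.

Lemma trmxC_sign_mx : D ^t* = D.
Proof.
apply/matrixP => j k; rewrite !mxE rmorphMn/= (CrealP (d_real _)) eq_sym.
by have [->|] := eqVneq j k.
Qed.

Lemma trmxC_twist : h ^t* = D *m u *m D.
Proof. by rewrite /h !trmxC_mul trmxC_sign_mx trmxCK mulmxA. Qed.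

(** In the frame [h] both sides are conjugates by [D], so it remains to compare i (l_k - l_j) P_jk
    with i |l_j - l_k| A_jk. *)
Lemma twisted_velocity :
  D *m u ^t* *m (P *m diag_mx (\row_j ('i * l j)) - diag_mx (\row_j ('i * l j)) *m P)
    *m u *m D =
  schur h (fun j k => - gap l j k) (diag_mx (\row_j (- 'i * l j))).
Proof.
have /unitarymxP uuJ := uu; have uJu := unitary_mulJ uu.
have uh : h \is unitarymx.
  apply/unitarymxP; rewrite trmxC_twist /h !mulmxA -(mulmxA _ D D) sign_mxK mulmx1.
  by rewrite -(mulmxA D (u ^t*) u) uJu mulmx1 sign_mxK.
set X := P *m _ - _; apply: (coords_inj uh) => j k.
rewrite (coords_schur uh).
have -> : coords h (D *m u ^t* *m X *m u *m D) = D *m X *m D.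
  rewrite /coords trmxC_twist /h !mulmxA -(mulmxA _ D D) sign_mxK mulmx1.
  rewrite -(mulmxA _ D D) sign_mxK mulmx1 -(mulmxA D u) uuJ mulmx1.
  by rewrite -(mulmxA _ u (u ^t*)) uuJ mulmx1.
have -> : coords h (diag_mx (\row_j (- 'i * l j))) = D *m ((- 'i) *: A) *m D.
  rewrite /coords trmxC_twist /h /A.
  have -> : diag_mx (\row_j0 (- 'i * l j0)) = (- 'i) *: diag_mx (\row_j0 l j0).
    by apply/matrixP => a b; rewrite !mxE mulrnAr.
  rewrite -!scalemxAr -!scalemxAl; congr (_ *: _).
  rewrite !mulmxA -(mulmxA _ D (diag_mx _)) [D *m diag_mx _]diag_mxC !mulmxA.
  by rewrite -(mulmxA _ D D) sign_mxK mulmx1.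
have DXD (Z : M) : (D *m Z *m D) j k = d 0 j * Z j k * d 0 k.
  by rewrite mul_mx_diag mxE mul_diag_mx mxE.
rewrite !DXD [(_ *: A) j k]mxE.
have -> : X j k = 'i * (l k - l j) * P j k.
  by rewrite mxE mul_mx_diag mxE mxE mxE mul_diag_mx mxE mxE; ring.
(* The sign of l_k - l_j is the one relating [P] to [A] on each side of the diagonal; on the
   diagonal both sides vanish. *)
have [jk|kj|/val_inj ->] := ltngtP j k.
- rewrite P_up// /gap gtr0_norm ?subr_gt0 ?l_decr//; ring.
- rewrite P_low// /gap distrC gtr0_norm ?subr_gt0 ?l_decr//; ring.
- by rewrite /gap !subrr normr0; ring.
Qed.

End TwistedVelocity.

(** * The projection to skew-Hermitian matrices *)

Section ProjectionToSkewHermitian.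
Variables (R : realType) (n : nat).
Local Open Scope sesquilinear_scope.
Local Notation M := 'M[R[i]]_n.
Implicit Types A N : M.

Lemma pi_uP N : [/\ skewherm (pi_u N), is_upper_mx (N - pi_u N)
  & forall i, (N - pi_u N) i i \is Num.real].
Proof.
apply: (@xgetPex _ _ [set P | [/\ skewherm P, is_upper_mx (N - P)
  & forall i, (N - P) i i \is Num.real]]).
(* Triangularity of the difference dictates the part below the diagonal, skewness the part above;
   the diagonal takes the imaginary part of that of [N]. *)
exists (\matrix_(j, k) (if (k < j)%N then N j k else if (j < k)%N then - (N k j)^*
  else (N j j - (N j j)^*) / 2)); split.
- apply/skewhermP => j k; rewrite !mxE.
  have [jk|kj|/val_inj ->] := ltngtP j k.
  + by rewrite opprK.
  + by rewrite rmorphN/= conjCK.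
  + rewrite rmorphM/= rmorphB/= conjCK fmorphV/= rmorph_nat.
    by rewrite -mulNr opprB.
- by apply/is_upper_mxP => j k kj; rewrite !mxE kj subrr.
- move=> i; rewrite !mxE ltnn; apply/CrealP.
  rewrite rmorphB/= rmorphM/= rmorphB/= conjCK fmorphV/= rmorph_nat.
  have two0 : (2 : R[i]) != 0 by rewrite pnatr_eq0.
  by field.
Qed.

(** A Hermitian [A] has real diagonal, so the diagonal of its projection is both real and imaginary,
    hence zero; skewness reverses the sign above the diagonal. *)
Lemma pi_u_hermE A : A ^t* = A -> forall j k,
  pi_u A j k = if (k < j)%N then A j k else if (j < k)%N then - A j k else 0.
Proof.
move=> hA; have [/skewhermP sP /is_upper_mxP uP rP] := pi_uP A.
have hAjk j k : (A k j)^* = A j k by rewrite -[in RHS]hA !mxE.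
have low (j k : 'I_n) : (k < j)%N -> pi_u A j k = A j k.
  by move=> /uP; rewrite !mxE => /eqP; rewrite subr_eq0 => /eqP.
move=> j k; have [jk|kj|/val_inj ->] := ltngtP j k.
- by apply: oppr_inj; rewrite -sP low// hAjk opprK.
- exact: low.
- have /CrealP := rP k; rewrite !mxE rmorphB/= hAjk sP => /addrI/oppr_inj/eqP.
  by rewrite eq_sym -addr_eq0 -mulr2n mulrn_eq0 => /eqP.
Qed.

Lemma skewherm_scaleNi (L : M) : skewherm L -> (- 'i *: L) ^t* = - 'i *: L.
Proof.
move=> /skewhermP sL; apply/matrixP => j k; rewrite !mxE rmorphM/= sL.
by rewrite rmorphN/= conjCi opprK mulrN mulNr.
Qed.

End ProjectionToSkewHermitian.

(** * The Toda flow *)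

Section MatrixIdentities.
Variables (C : numClosedFieldType) (n : nat).
Local Open Scope sesquilinear_scope.
Local Notation M := 'M[C]_n.
Implicit Types A P u v D Z : M.

(** Along v' = (A - P) v the skew term cancels from the derivative of the Gram matrix, and the
    eigenvector equation turns [A] into [D]. *)
Lemma gram_velocity A P v D : A ^t* = A -> P ^t* = - P -> A *m v = v *m D ->
  ((A - P) *m v) ^t* *m v + v ^t* *m ((A - P) *m v) = 2 *: (v ^t* *m v *m D).
Proof.
move=> hA sP Av; rewrite trmxC_mul linearB/= map_mxB hA sP opprK -mulmxA -mulmxDr.
rewrite -mulmxDl addrACA subrr addr0 -mulr2n -scaler_nat -scalemxAl Av.
by rewrite -scalemxAr mulmxA.
Qed.

(** The product rule along u' = - P u; skewness of [P] makes the two terms a commutator. *)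
Lemma conjugate_velocity P u D Z : P ^t* = - P ->
  D *m ((- P *m u) ^t* *m Z *m u + u ^t* *m Z *m (- P *m u)) *m D =
  D *m u ^t* *m (P *m Z - Z *m P) *m u *m D.
Proof.
move=> sP; have sPN : (- P) ^t* = P by rewrite raddfN/= map_mxN sP opprK.
rewrite trmxC_mul sPN mulNmx mulmxN !mulmxA; congr (_ *m _).
by rewrite mulmxBr !mulmxA mulmxBr mulmxBl !mulmxA.
Qed.

Lemma unitary_conjugateE A u D : u \is unitarymx -> A *m u = u *m D ->
  A = u *m D *m u ^t*.
Proof. by move=> /unitarymxP uu <-; rewrite -mulmxA uu mulmx1. Qed.

End MatrixIdentities.

(** * The moving unitary frame of a Toda solution *)

Section TodaFlow.
Variables (R : realType) (n : nat) (lambda : 'rV[R]_n).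
Local Open Scope sesquilinear_scope.
Local Notation M := 'M[R[i]]_n.

Let Lam : M := diag_mx (\row_j (lambda 0 j)%:C).

Lemma i_diagE : i_diag lambda = 'i *: Lam.
Proof. by apply/matrixP => j k; rewrite !mxE mulrnAr. Qed.

Lemma orbit_point_eigen (A u : M) : u \is unitarymx -> A *m u = u *m Lam ->
  orbit_point lambda u = 'i *: A.
Proof.
move=> uu /(unitary_conjugateE uu) ->.
by rewrite /orbit_point (invmx_unitary uu) i_diagE -scalemxAr -scalemxAl.
Qed.

Lemma orbit_point_eigenE (A u : M) : u \is unitarymx ->
  orbit_point lambda u = 'i *: A -> A *m u = u *m Lam.
Proof.
rewrite /orbit_point i_diagE -scalemxAr -scalemxAl => uu /scalerI e.
by rewrite -e ?neq0Ci// mulmxKV ?unitarymx_unit.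
Qed.

Definition exp_diag (t : R) : M := diag_mx (\row_j (expR (- lambda 0 j * t))%:C).

Lemma is_mx_derive_exp_diag t : is_mx_derive exp_diag t (- (Lam *m exp_diag t)).
Proof.
move=> j k.
suff : is_cderive (fun s => exp_diag s j k) t ((- (Lam *m exp_diag t)) j k) by [].
rewrite mxE mul_diag_mx !mxE; under eq_fun do rewrite !mxE.
have [->|_] := eqVneq j k; last by rewrite mulr0 oppr0; exact: is_cderive_cst.
by apply: is_cderive_eq (is_cderive_expR _ _) _; rewrite rmorphN/= mulNr.
Qed.

Lemma trmxC_exp_diag t : (exp_diag t) ^t* = exp_diag t.
Proof.
apply/matrixP => j k; rewrite !mxE rmorphMn/= conjC_realC eq_sym.
by have [->|] := eqVneq j k.
Qed.

Variables (J : set R) (L : R -> M).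
Hypotheses (J_open : open J) (J_interval : is_interval J) (J0 : J 0).
Hypothesis lambda_decr : forall i j : 'I_n, (i < j)%N -> lambda 0 j < lambda 0 i.
Hypothesis LO : forall t, J t -> adjoint_orbit lambda (L t).
Let A (t : R) : M := - 'i *: L t.
Let P (t : R) : M := pi_u (A t).
Hypothesis dL : forall t, J t -> is_mx_derive L t (commx (L t) (P t)).

Lemma toda_herm t : J t -> (A t) ^t* = A t.
Proof.
move=> /LO[g ug Lg]; apply: skewherm_scaleNi; rewrite Lg.
exact: skewherm_orbit_point.
Qed.

Lemma toda_skew t : (P t) ^t* = - P t.
Proof. by have [] := pi_uP (A t). Qed.

(** This is A - P on [J], written through the entries of [A] so that triangularity and continuity
    can be read off without studying [pi_u] along the curve. *)
Let U (t : R) : M := \matrix_(j, k)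
  (if (k < j)%N then 0 else if (j < k)%N then 2 * A t j k else A t j k).

Lemma toda_split t : J t -> U t = A t - P t.
Proof.
move=> Jt; apply/matrixP => j k; rewrite mxE [RHS]mxE [X in _ + X]mxE.
rewrite (pi_u_hermE (toda_herm Jt)).
have [jk|kj|_] := ltngtP j k; first by rewrite opprK mulrDl mul1r.
  by rewrite subrr.
by rewrite subr0.
Qed.

Lemma toda_upper t : is_upper_mx (U t).
Proof. by apply/is_upper_mxP => j k kj; rewrite mxE kj. Qed.

Lemma toda_upper_real t : J t -> forall j, U t j j = (complex.Re (U t j j))%:C.
Proof.
move=> Jt j; rewrite RRe_real// mxE ltnn; apply/CrealP.
by have /matrixP/(_ j j) := toda_herm Jt; rewrite !mxE.
Qed.

(** The Lax form in the triangular factor: A' = [A, P] = [A, A - U] = [U, A]. *)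
Lemma toda_herm_derive t : J t ->
  is_mx_derive A t (U t *m A t - A t *m U t).
Proof.
move=> Jt; have := is_mx_deriveZ (- 'i) (dL Jt).
suff -> : - 'i *: commx (L t) (P t) = U t *m A t - A t *m U t by [].
have -> : P t = A t - U t by rewrite toda_split// subKr.
rewrite /commx scalerBr scalemxAl scalemxAr -/(A t).
by rewrite mulmxBr mulmxBl opprB addrC addrA subrK.
Qed.

Lemma toda_upper_continuous t : J t -> forall j k, ccontinuous (fun s => U s j k) t.
Proof.
move=> Jt j k.
have Ac : ccontinuous (fun s => A s j k) t.
  exact: is_cderive_continuous (toda_herm_derive Jt j k).
under eq_fun do rewrite mxE.
case: (k < j)%N; first exact: ccontinuous_cst.
case: (j < k)%N; last exact: Ac.
by apply: ccontinuousM; [exact: ccontinuous_cst|exact: Ac].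
Qed.

(* The solution is [v t = r t *m g0], with [r] upper triangular, normalised by
   [exp_diag t]: left multiplication by [r t] does not leave the Schubert cell. *)
Lemma toda_unitary_frame : exists u : R -> M, forall t, J t ->
  [/\ positive_bruhat (u t), L t = orbit_point lambda (u t)
    & is_mx_derive u t (- P t *m u t)].
Proof.
have [g0 [ug0 [w [b [S [c [bb Sw bc g0E bc0]]]]]] L0E] :=
  adjoint_orbit_positive_bruhat (LO J0).
have Aig0 : A 0 *m g0 = g0 *m Lam.
  apply: orbit_point_eigenE ug0 _.
  by rewrite -L0E /A scalerA mulrN -expr2 sqrCi opprK scale1r.
have [r r0 dr] := upper_ode_exists J_open J_interval J0 (fun t _ => toda_upper t)
  toda_upper_real toda_upper_continuous 1%:M.
have rB := upper_ode_borel J_open J_interval J0 (fun t _ => toda_upper t)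
  toda_upper_real toda_upper_continuous dr r0.
pose v t := r t *m g0.
have v0 : v 0 = g0 by rewrite /v r0 mul1mx.
have dv t : J t -> is_mx_derive v t (U t *m v t).
  by move=> Jt; have := is_mx_deriveMr g0 (dr t Jt); rewrite -mulmxA.
have Av t : J t -> A t *m v t = v t *m Lam.
  move=> Jt; apply/eqP; rewrite -subr_eq0; apply/eqP; move: t Jt.
  apply: (upper_ode_zero J_open J_interval J0 (fun t _ => toda_upper t)
    toda_upper_real toda_upper_continuous (r := fun t => A t *m v t - v t *m Lam)).
    move=> t Jt; have := is_mx_deriveB
      (is_mx_deriveM (toda_herm_derive Jt) (dv t Jt)) (is_mx_deriveMr Lam (dv t Jt)).
    by rewrite lax_identity.
  by rewrite v0 Aig0 subrr.
(* Each entry of the Gram matrix solves a scalar equation with rate [2 * lambda 0 k], starting from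
   the identity since [g0] is unitary. *)
have vv t j k : J t ->
    ((v t) ^t* *m v t) j k = (j == k)%:R * (expR (2 * lambda 0 k * t))%:C.
  move=> Jt.
  have dW s : J s -> is_cderive (fun x => ((v x) ^t* *m v x) j k) s
      ((2 * lambda 0 k)%:C * ((v s) ^t* *m v s) j k).
    move=> Js; have dG := is_mx_deriveM (is_mx_derive_trmxC (dv s Js)) (dv s Js).
    rewrite toda_split// (gram_velocity (toda_herm Js) (toda_skew s) (Av s Js)) in dG.
    apply: is_cderive_eq (dG j k) _.
    rewrite mxE mul_mx_diag mxE [X in _ * (_ * X)]mxE rmorphM/= rmorph_nat.
    by rewrite mulrCA mulrC.
  have dC s : J s -> is_derive s (1 : R) (fun x => 2 * lambda 0 k * x) (2 * lambda 0 k).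
    move=> _; have -> : (fun x => 2 * lambda 0 k * x) = (2 * lambda 0 k) \*: id by [].
    apply: is_derive_eq (is_deriveZ _ (is_derive_id s 1)) _.
    by rewrite /GRing.scale/= mulr1.
  rewrite (linear_ode_unique J_interval J0 _ dC dW Jt) ?mulr0//; congr (_ * _).
  by rewrite v0 (unitary_mulJ ug0) mxE.
pose u t := v t *m exp_diag t.
have uu t : J t -> u t \is unitarymx.
  move=> Jt; suff uJu : (u t) ^t* *m u t = 1%:M.
    by apply/unitarymxP; exact: mulmx1C uJu.
  rewrite /u trmxC_mul trmxC_exp_diag -mulmxA (mulmxA _ (v t)).
  apply/matrixP => j k; rewrite mul_diag_mx [LHS]mxE mul_mx_diag [X in _ * X]mxE.
  rewrite vv// !mxE; have [->|_] := eqVneq j k; last by rewrite !mul0r mulr0.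
  rewrite mul1r -!rmorphM/= -!expRD.
  have -> : forall x y : R, - x * y + (2 * x * y + - x * y) = 0.
    by move=> x y; ring.
  by rewrite expR0.
have Au t : J t -> A t *m u t = u t *m Lam.
  by move=> Jt; rewrite /u mulmxA Av// -!mulmxA diag_mxC.
exists u => t Jt; split.
- split; first exact: uu.
  have [bt rpos] := rB t Jt.
  exists w, (r t *m b), S, (c *m exp_diag t).
  have bE : borel (exp_diag t).
    by apply: borel_diag => j; rewrite mxE gt_eqF// ltcR expR_gt0.
  split; [exact: borel_mul|exact: Sw|exact: borel_mul|by rewrite /u /v g0E !mulmxA|].
  move=> j; rewrite (mul_upper_diag _ bt.2 bb.2) (mul_upper_diag _ bc.2 bE.2).
  rewrite mulrA -(mulrA (r t _ _)); apply: mulr_gt0.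
    by apply: mulr_gt0; [exact: rpos|exact: bc0].
  by rewrite mxE eqxx mulr1n mxE ltcR expR_gt0.
- rewrite (orbit_point_eigen (uu t Jt) (Au t Jt)) /A scalerA mulrN -expr2 sqrCi.
  by rewrite opprK scale1r.
(* The product rule gives u' = U u - v Lambda exp(-t Lambda); the last term is A u, which leaves (U
   - A) u = - P u. *)
- have := is_mx_deriveM (dv t Jt) (is_mx_derive_exp_diag t).
  rewrite mulmxN (mulmxA (v t)) -(Av t Jt) -(mulmxA (A t)) -(mulmxA (U t)) -/(u t).
  by rewrite -mulmxBl toda_split// addrAC subrr sub0r.
Qed.

End TodaFlow.

(** * The gradient of the height function *)

Section GradientOfHeight.
Variables (R : realType) (n : nat).
Local Notation M := 'M[R[i]]_n.

Lemma is_cderive_mxtrace (f : R -> M) t (D : M) :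
  is_mx_derive f t D -> is_cderive (fun s => \tr (f s)) t (\tr D).
Proof. by move=> fD; apply: is_cderive_sum => i; exact: fD. Qed.

Lemma is_derive_nu (f : R -> M) t (D N : M) :
  is_mx_derive f t D -> is_derive t (1 : R) (fun s => nu (f s) N) (nu D N).
Proof.
move=> fD.
suff [] : is_cderive (fun s => 2 * n%:R * \tr (f s *m N) - 2 * \tr (f s) * \tr N) t
    (2 * n%:R * \tr (D *m N) - 2 * \tr D * \tr N) by [].
have d1 := is_cderive_mxtrace (is_mx_deriveMr N fD).
have d2 := is_cderive_mxtrace fD.
apply: is_cderive_eq (is_cderiveB (is_cderiveM (is_cderive_cst (2 * n%:R) t) d1)
  (is_cderiveM (is_cderiveM (is_cderive_cst 2 t) d2) (is_cderive_cst (\tr N) t))) _.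
by rewrite !mul0r !add0r mulr0 addr0.
Qed.

Lemma is_mx_derive_near (f g : R -> M) t (D : M) :
  (\forall s \near t, f s = g s) -> is_mx_derive f t D -> is_mx_derive g t D.
Proof.
move=> fg fD i j; have [f1 f2] := fD i j; split.
  by apply: near_eq_is_derive f1; apply: filterS fg => s ->.
by apply: near_eq_is_derive f2; apply: filterS fg => s ->.
Qed.

Lemma is_gradient_kahler_grad (lambda : 'rV[R]_n) (h N : M) :
  (forall i j : 'I_n, (i < j)%N -> lambda 0 j < lambda 0 i) ->
  h \is unitarymx -> skewherm N ->
  is_gradient (adjoint_orbit lambda) (@kahler_metric R n) (fun X => nu X N)
    (orbit_point lambda h) (kahler_grad lambda h N).
Proof.
move=> lambda_decr uh sN; split; first exact: im_ad_kahler_grad.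
move=> X c sX c0 _ dc; rewrite (kahler_metric_grad lambda_decr uh sN sX).
exact: is_derive_nu dc.
Qed.

End GradientOfHeight.

(** * The twisted curve and its velocity *)

Section TwistedToda.
Variables (R : realType) (n : nat) (lambda : 'rV[R]_n).
Local Open Scope sesquilinear_scope.
Local Notation M := 'M[R[i]]_n.

Let l (j : 'I_n) : R[i] := (lambda 0 j)%:C.
Let d : 'rV[R[i]]_n := \row_(j < n) (-1) ^+ j.

Lemma delta_sign j : d 0 j * d 0 j = 1.
Proof. by rewrite mxE -exprMn mulrNN mulr1 expr1n. Qed.

Lemma delta_real j : d 0 j \is Num.real.
Proof. by rewrite mxE rpredX// rpredN rpred1. Qed.

(** The two inner factors delta cancel, since delta commutes with diagonal matrices and squares to
    one. *)
Lemma orbit_point_iota (u : M) : u \is unitarymx ->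
  orbit_point lambda (Defs.iota u) =
  delta R n *m (u ^t* *m i_diag lambda *m u) *m delta R n.
Proof.
move=> uu; have uh := iota_unitary uu.
rewrite /orbit_point (invmx_unitary uh) /Defs.iota (invmx_unitary uu) -/d.
rewrite (trmxC_twist u delta_real) -!mulmxA; congr (_ *m (_ *m _)).
rewrite !mulmxA; congr (_ *m _ *m _).
by rewrite /i_diag diag_mxC -mulmxA (sign_mxK delta_sign) mulmx1.
Qed.

Hypothesis lambda_decr : forall i j : 'I_n, (i < j)%N -> lambda 0 j < lambda 0 i.

(** The product rule yields the left side of [twisted_velocity], applied to the Hermitian matrix
    -iL, on which [pi_u] is explicit. *)
Lemma is_mx_derive_orbit_iota (u : R -> M) t (L : M) :
  u t \is unitarymx -> L = orbit_point lambda (u t) -> skewherm L ->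
  is_mx_derive u t (- pi_u (- 'i *: L) *m u t) ->
  is_mx_derive
    (fun s => delta R n *m ((u s) ^t* *m i_diag lambda *m u s) *m delta R n) t
    (kahler_grad lambda (Defs.iota (u t)) (diag_mx (\row_j (- 'i * (lambda 0 j)%:C)))).
Proof.
move=> uu LE sL du; set P := pi_u _ in du.
have sP : P ^t* = - P by have [] := pi_uP (- 'i *: L).
have hA := skewherm_scaleNi sL.
have AE : - 'i *: L = u t *m diag_mx (\row_j l j) *m (u t) ^t*.
  apply: (unitary_conjugateE uu); apply: (orbit_point_eigenE uu).
  by rewrite -LE scalerA mulrN -expr2 sqrCi opprK scale1r.
have := is_mx_deriveMr (delta R n) (is_mx_deriveMl (delta R n)
  (is_mx_deriveM (is_mx_deriveMr (i_diag lambda) (is_mx_derive_trmxC du)) du)).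
rewrite (conjugate_velocity (u t) (delta R n) (i_diag lambda) sP).
rewrite /kahler_grad /Defs.iota (invmx_unitary uu).
have l_decr (j k : 'I_n) : (j < k)%N -> l k < l j by move=> /lambda_decr; rewrite /l ltcR.
have P_low (j k : 'I_n) : (k < j)%N ->
    P j k = (u t *m diag_mx (\row_j l j) *m (u t) ^t*) j k.
  by move=> kj; rewrite /P (pi_u_hermE hA) kj AE.
have P_up (j k : 'I_n) : (j < k)%N ->
    P j k = - (u t *m diag_mx (\row_j l j) *m (u t) ^t*) j k.
  by move=> jk; rewrite /P (pi_u_hermE hA) ltnNge (ltnW jk)/= jk AE.
by rewrite -(twisted_velocity l_decr delta_sign delta_real uu P_low P_up).
Qed.

End TwistedToda.

Theorem theorem1p1 (R : realType) (n : nat) (lambda : 'rV[R]_n)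
    (lambda_decr : forall i j : 'I_n, (i < j)%N -> lambda 0 j < lambda 0 i)
    (J : set R) (J_open : open J) (J_interval : is_interval J) (J0 : J 0)
    (L0 : 'M[R[i]]_n) (L : R -> 'M[R[i]]_n) :
  toda_flow lambda J L0 L ->
  gradient_flow (adjoint_orbit lambda) (@kahler_metric R n)
    (fun M => nu M (diag_mx (\row_j (- 'i * (lambda 0 j)%:C))))
    J (twist_orbit lambda L0) (fun t => twist_orbit lambda (L t)).
Proof.
move=> [L00 LO dL].
(* The frame stays canonical on [J], so one explicit formula describes the twist along the whole
   curve. *)
have [u uP] := toda_unitary_frame J_open J_interval J0 LO dL.
have uu t : J t -> u t \is unitarymx by move=> /uP[[]].
have twistE t : J t -> twist_orbit lambda (L t) = orbit_point lambda (Defs.iota (u t)).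
  by move=> /uP[pu -> _]; exact: twist_orbitE.
have sN : skewherm (diag_mx (\row_j (- 'i * (lambda 0 j)%:C))).
  apply/skewhermP => j k; rewrite !mxE rmorphMn/= rmorphM/= rmorphN/= conjCi.
  rewrite conjC_realC opprK mulNr mulNrn opprK eq_sym.
  by have [->|] := eqVneq j k.
split=> [|t Jt|t Jt]; first by rewrite L00.
  rewrite twistE//; exists (Defs.iota (u t)) => //; exact: iota_unitary (uu t Jt).
exists (kahler_grad lambda (Defs.iota (u t)) (diag_mx (\row_j (- 'i * (lambda 0 j)%:C)))).
  rewrite twistE//; apply: is_gradient_kahler_grad => //.
  exact: iota_unitary (uu t Jt).
have [_ LE du] := uP t Jt.
have sL : skewherm (L t) by rewrite LE; exact: skewherm_orbit_point (uu t Jt).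
(* The explicit formula is known for times in [J], which is a neighbourhood of [t]; that suffices to
   transfer the derivative. *)
apply: is_mx_derive_near (is_mx_derive_orbit_iota lambda_decr (uu t Jt) LE sL du).
have Jt_near : \forall s \near t, J s by exact: open_nbhs_nbhs.
apply: (filterS _ Jt_near) => s Js; rewrite twistE//.
by rewrite orbit_point_iota//; exact: uu.
Qed.
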